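(* Let $A=T(R,\sigma,v)$ be a generalized Weyl algebra whose data satisfy condition $(\ast)$. The set $\{P_W[n]:W\in\pi_0(Z),\ n\in\mathbf{Z}\}$ forms a system of projective generators for $\mathcal{O}^+$. The set $\{P_W: W\in\pi_0(Z)\}$ (with gradings forgotten) forms a system of projective generators for $\mathcal{O}$.
   Context: **GWA.** $R$ is a finitely generated commutative $\mathbf{C}$-algebra, $\sigma$ a $\mathbf{C}$-algebra automorphism of $R$, $v\in R$. $A=T(R,\sigma,v)$ is the $\mathbf{C}$-algebra generated by $R$, $t_+$, $t_-$ subject to $r t_+=t_+\sigma(r)$, $\sigma(r)t_-=t_-r$, $t_-t_+=\sigma(v)$, $t_+t_-=v$ for $r\in R$; it is $\mathbf{Z}$-graded with $\deg t_\pm=\pm1$ and $\deg r=0$ for $r\in R$. Graded modules are $\mathbf{Z}$-graded left modules, with degree-preserving maps and shift $M[n]_i=M_{i+n}$. **Categories.** An $A$-module $M$ is locally nilpotent if for every $m\in M$, $t_-^nm=0$ for $n\gg0$. $\mathcal{O}^+$ is the category of graded locally nilpotent $A$-modules; $\mathcal{O}$ is the category of ungraded locally nilpotent $A$-modules. **Right $R$-structure and support.** Every graded $A$-module $M$ is an $(A,R)$-bimodule via $x\cdot r=\sigma^{-i}(r)x$ for $x\in M_i$, $r\in R$. $\operatorname{ann}(M)$ is the annihilator of $M$ as a right $R$-module and $\operatorname{supp}(M)=\{\mathfrak{p}\in\operatorname{Spec}R:\operatorname{ann}(M)\subset\mathfrak{p}\}$. If $W$ is a union of connected components of $\operatorname{supp}(M)$,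 the summand $M_W$ of $M$ supported on $W$ is $M\cdot 1_W$, where $1_W\in R/\operatorname{ann}(M)$ is the idempotent corresponding to the open-closed subset $W$. **Condition $(\ast)$.** Let $Z=\{\mathfrak{p}\in\operatorname{Spec}R:v\in\mathfrak{p}\}$, let $\pi_0(Z)$ be its set of connected components, and let $\Xi(\mathfrak{p})=\sigma^{-1}(\mathfrak{p})$ on $\operatorname{Spec}R$. $(\ast)$: for every connected component $W$ of $Z$ and every $n\in\mathbf{Z}$, $W\cap\Xi^n(Z)$ is either empty or a connected component of $Z$, and for $n\gg0$, $W\cap\Xi^n(Z)=\varnothing$. **The modules $P_W$.** For $n>0$ let $A(n)=A/At_-^n$; its support is contained in $\bigcup_{j=0}^{n-1}\Xi^j(Z)$. For $W\in\pi_0(Z)$, choose $N$ so large that $W\cap\Xi^n(Z)=\varnothing$ for all $n\ge N$, and let $P_W=A(N)_W$ be the summand of $A(N)$ supported on $W$; under $(\ast)$ it is independent of such $N$ up to canonical isomorphism. *)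

(* Defs.v *)
From HB Require Import structures.
From mathcomp Require Import all_boot all_order all_algebra.
From mathcomp Require Import complex.
From mathcomp Require Import all_classical all_reals topology.

Set Implicit Arguments.
Unset Strict Implicit.
Unset Printing Implicit Defensive.

Import GRing.Theory.

Local Open Scope quotient_scope.
Local Open Scope classical_set_scope.
Local Open Scope ring_scope.

Record category := Category {
  Ob : Type;
  Hom : Ob -> Ob -> Type;
  idC : forall X, Hom X X;
  compC : forall X Y Z, Hom Y Z -> Hom X Y -> Hom X Z;
  comp1C : forall X Y (f : Hom X Y), compC (idC Y) f = f;
  compC1 : forall X Y (f : Hom X Y), compC f (idC X) = f;
  compCA : forall X Y Z T (h : Hom Z T) (g : Hom Y Z) (f : Hom X Y),
    compC h (compC g f) = compC (compC h g) f
}.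

Section CategoryNotions.
Variable C : category.

Definition epi (X Y : Ob C) (f : Hom X Y) : Prop :=
  forall (Z : Ob C) (g h : Hom Y Z), compC g f = compC h f -> g = h.

Definition projective_object (P : Ob C) : Prop :=
  forall (X Y : Ob C) (e : Hom X Y) (g : Hom P Y),
    epi e -> exists h : Hom P X, compC e h = g.

(* Generators in the sense of separators: parallel morphisms which agree after
   composition with every morphism from every P i are equal. *)
Definition generating_family (I : Type) (P : I -> Ob C) : Prop :=
  forall (X Y : Ob C) (f g : Hom X Y),
    (forall (i : I) (h : Hom (P i) X), compC f h = compC g h) -> f = g.

Definition projective_generators (I : Type) (P : I -> Ob C) : Prop :=
  (forall i, projective_object (P i)) /\ generating_family P.

End CategoryNotions.

(* A commutative algebra over [k] is a commutative ring [R] together with its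
   structure map [iota : {rmorphism k -> R}]; MathComp's [comAlgType] would
   exclude the zero algebra. *)
Definition fg_algebra (k R : comPzRingType) (iota : {rmorphism k -> R}) : Prop :=
  exists s : seq R, forall S : {pred R},
    subring_closed S -> (forall c, iota c \in S) -> {subset s <= S} ->
    forall r, r \in S.

Record ringAut (R : pzRingType) := RingAut {
  aut :> {rmorphism R -> R};
  autV : {rmorphism R -> R};
  autK : cancel aut autV;
  autVK : cancel autV aut
}.

(* [iterz f g n] is [f] iterated [n] times, where [g] is the inverse of [f]. *)
Definition iterz (T : Type) (f g : T -> T) (n : int) : T -> T :=
  match n with Posz m => iter m f | Negz m => iter m.+1 g end.

Definition aut_pow (R : pzRingType) (sigma : ringAut R) : int -> R -> R :=
  iterz sigma (autV sigma).

Section Spectrum.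
Variable R : comPzRingType.

Record prime_ideal (p : set R) : Prop := PrimeIdeal {
  prime_ideal0 : p 0;
  prime_idealD : forall x y, p x -> p y -> p (x + y);
  prime_idealMr : forall a x, p x -> p (a * x);
  prime_ideal1 : ~ p 1;
  prime_idealP : forall x y, p (x * y) -> p x \/ p y
}.

Record Spec := SpecPoint {
  spec_ideal :> set R;
  spec_prime : prime_ideal spec_ideal
}.

Definition zeros (S : set R) : set Spec := [set p : Spec | S `<=` p].

Definition zariski_open (U : set Spec) : Prop :=
  exists S : set R, U = ~` zeros S.

Lemma zariski_openT : zariski_open setT.
Proof.
exists [set 1]; apply/seteqP; split => // p _ /= /(_ 1 erefl).
exact: prime_ideal1 (spec_prime p).
Qed.

Lemma zariski_openI : setI_closed zariski_open.
Proof.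
move=> _ _ [S ->] [T ->]; exists [set x * y | x in S & y in T].
rewrite -setCU; congr (~` _); apply/seteqP; split => p /=.
  move=> + _ [x Sx [y Ty <-]]; have pp := spec_prime p => -[/(_ x Sx)|/(_ y Ty)].
    by rewrite mulrC; apply: prime_idealMr.
  exact: prime_idealMr.
move=> STp; apply: contrapT => /not_orP[/existsNP[x /not_implyP[Sx px]]].
move=> /existsNP[y /not_implyP[Ty py]].
have /(prime_idealP (spec_prime p)) [//|//] : spec_ideal p (x * y).
by apply: STp; exists x => //; exists y.
Qed.

Lemma zariski_open_bigU (I : Type) (f : I -> set Spec) :
  (forall i, zariski_open (f i)) -> zariski_open (\bigcup_i f i).
Proof.
move=> /choice[S fS]; exists (\bigcup_i S i).
apply/seteqP; split => p /=.
  by move=> [i _]; rewrite fS => nS Sp; apply: nS => x Sx; apply: Sp; exists i.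
move=> nS; apply: contrapT => nf; apply: nS => x [i _ Six].
apply: contrapT => npx; apply: nf; exists i => //; rewrite fS => Sp.
exact: npx (Sp _ Six).
Qed.

HB.instance Definition _ := gen_eqMixin Spec.
HB.instance Definition _ := gen_choiceMixin Spec.
HB.instance Definition _ := isOpenTopological.Build Spec
  zariski_openT zariski_openI zariski_open_bigU.

End Spectrum.

Lemma preimage_prime (R S : comPzRingType) (f : {rmorphism R -> S}) (p : Spec S) :
  prime_ideal (f @^-1` p).
Proof.
have pp := spec_prime p; split => /=.
- by rewrite rmorph0; apply: prime_ideal0.
- by move=> x y; rewrite rmorphD; apply: prime_idealD.
- by move=> a x; rewrite rmorphM; apply: prime_idealMr.
- by rewrite rmorph1; apply: prime_ideal1.
- by move=> x y; rewrite rmorphM; apply: prime_idealP.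
Qed.

Definition spec_preimage (R S : comPzRingType) (f : {rmorphism R -> S})
  (p : Spec S) : Spec R := SpecPoint (preimage_prime f p).

Definition Xi_pow (R : comPzRingType) (sigma : ringAut R) : int -> Spec R -> Spec R :=
  iterz (spec_preimage sigma) (spec_preimage (autV sigma)).

Definition pi0 (T : topologicalType) (Z : set T) : set (set T) :=
  connected_component Z @` Z.

Definition Zset (R : comPzRingType) (v : R) : set (Spec R) := [set p : Spec R | spec_ideal p v].

Definition condition_star (R : comPzRingType) (sigma : ringAut R) (v : R) : Prop :=
  let Z := Zset v in
  forall W, pi0 Z W ->
    (forall n : int, W `&` (Xi_pow sigma n @` Z) = set0
                     \/ pi0 Z (W `&` (Xi_pow sigma n @` Z)))
    /\ exists N : int, forall n : int, (N <= n)%R ->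
         W `&` (Xi_pow sigma n @` Z) = set0.

(* Formal expressions in the generators R, t+, t-. *)
Inductive gwa_term (R : Type) :=
  | GCoef of R
  | GTplus
  | GTminus
  | GAdd of gwa_term R & gwa_term R
  | GMul of gwa_term R & gwa_term R.
Arguments GTplus {R}.
Arguments GTminus {R}.

HB.instance Definition _ (R : Type) := gen_eqMixin (gwa_term R).
HB.instance Definition _ (R : Type) := gen_choiceMixin (gwa_term R).

Section GWA.
Variables (R : comPzRingType) (sigma : ringAut R) (v : R).

(* The least congruence for which expressions form a ring, R -> expressions is
   a ring morphism and the four families of defining relations hold. *)
Inductive gwa_rel : gwa_term R -> gwa_term R -> Prop :=
  | gwa_refl x : gwa_rel x x
  | gwa_sym x y : gwa_rel x y -> gwa_rel y x
  | gwa_trans y x z : gwa_rel x y -> gwa_rel y z -> gwa_rel x z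
  | gwa_congD x x' y y' : gwa_rel x x' -> gwa_rel y y' ->
      gwa_rel (GAdd x y) (GAdd x' y')
  | gwa_congM x x' y y' : gwa_rel x x' -> gwa_rel y y' ->
      gwa_rel (GMul x y) (GMul x' y')
  | gwa_addA x y z : gwa_rel (GAdd x (GAdd y z)) (GAdd (GAdd x y) z)
  | gwa_addC x y : gwa_rel (GAdd x y) (GAdd y x)
  | gwa_add0 x : gwa_rel (GAdd (GCoef 0) x) x
  | gwa_addN x : gwa_rel (GAdd (GMul (GCoef (- 1)) x) x) (GCoef 0)
  | gwa_mulA x y z : gwa_rel (GMul x (GMul y z)) (GMul (GMul x y) z)
  | gwa_mul1l x : gwa_rel (GMul (GCoef 1) x) x
  | gwa_mul1r x : gwa_rel (GMul x (GCoef 1)) x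
  | gwa_mulDl x y z : gwa_rel (GMul (GAdd x y) z) (GAdd (GMul x z) (GMul y z))
  | gwa_mulDr x y z : gwa_rel (GMul x (GAdd y z)) (GAdd (GMul x y) (GMul x z))
  | gwa_coefD r s : gwa_rel (GCoef (r + s)) (GAdd (GCoef r) (GCoef s))
  | gwa_coefM r s : gwa_rel (GCoef (r * s)) (GMul (GCoef r) (GCoef s))
  | gwa_coef_tplus r :
      gwa_rel (GMul (GCoef r) GTplus) (GMul GTplus (GCoef (sigma r)))
  | gwa_coef_tminus r :
      gwa_rel (GMul (GCoef (sigma r)) GTminus) (GMul GTminus (GCoef r))
  | gwa_tminus_tplus : gwa_rel (GMul GTminus GTplus) (GCoef (sigma v))
  | gwa_tplus_tminus : gwa_rel (GMul GTplus GTminus) (GCoef v).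

Definition gwa_relb (x y : gwa_term R) : bool := `[< gwa_rel x y >].

Lemma gwa_relb_refl : reflexive gwa_relb.
Proof. by move=> x; apply/asboolP; apply: gwa_refl. Qed.
Lemma gwa_relb_sym : symmetric gwa_relb.
Proof. by move=> x y; apply/asboolP/asboolP; apply: gwa_sym. Qed.
Lemma gwa_relb_trans : transitive gwa_relb.
Proof.
by move=> y x z /asboolP xy /asboolP yz; apply/asboolP; apply: gwa_trans yz.
Qed.

Canonical gwa_equiv := EquivRel gwa_relb gwa_relb_refl gwa_relb_sym gwa_relb_trans.

Definition gwa := {eq_quot gwa_equiv}.
HB.instance Definition _ := Choice.on gwa.

Definition gwa_pi (x : gwa_term R) : gwa := \pi_{eq_quot gwa_equiv} x.
Definition gwa_repr (a : gwa) : gwa_term R := repr a.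

Lemma gwa_reprK a : gwa_pi (gwa_repr a) = a.
Proof. exact: reprK. Qed.

Lemma gwa_piP x y : gwa_rel x y <-> gwa_pi x = gwa_pi y.
Proof.
split=> [xy|/eqmodP/asboolP//]; apply/eqmodP; exact/asboolP.
Qed.

Definition gwa_add (a b : gwa) : gwa := gwa_pi (GAdd (gwa_repr a) (gwa_repr b)).
Definition gwa_mul (a b : gwa) : gwa := gwa_pi (GMul (gwa_repr a) (gwa_repr b)).
Definition gwa_opp (a : gwa) : gwa := gwa_mul (gwa_pi (GCoef (- 1))) a.

Lemma gwa_pi_add x y : gwa_pi (GAdd x y) = gwa_add (gwa_pi x) (gwa_pi y).
Proof. by apply/gwa_piP/gwa_congD; apply/gwa_piP; rewrite gwa_reprK. Qed.
Lemma gwa_pi_mul x y : gwa_pi (GMul x y) = gwa_mul (gwa_pi x) (gwa_pi y).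
Proof. by apply/gwa_piP/gwa_congM; apply/gwa_piP; rewrite gwa_reprK. Qed.

Local Ltac gwa_lift ax :=
  rewrite -?(gwa_pi_mul, gwa_pi_add); apply/gwa_piP; apply: ax.

Fact gwa_addrA : associative gwa_add.
Proof.
move=> a b c; rewrite -[a]gwa_reprK -[b]gwa_reprK -[c]gwa_reprK.
by gwa_lift gwa_addA.
Qed.
Fact gwa_addrC : commutative gwa_add.
Proof. by move=> a b; rewrite -[a]gwa_reprK -[b]gwa_reprK; gwa_lift gwa_addC. Qed.
Fact gwa_add0r : left_id (gwa_pi (GCoef 0)) gwa_add.
Proof. by move=> a; rewrite -[a]gwa_reprK; gwa_lift gwa_add0. Qed.
Fact gwa_addNr : left_inverse (gwa_pi (GCoef 0)) gwa_opp gwa_add.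
Proof. by move=> a; rewrite /gwa_opp -[a]gwa_reprK; gwa_lift gwa_addN. Qed.
HB.instance Definition _ :=
  GRing.isZmodule.Build gwa gwa_addrA gwa_addrC gwa_add0r gwa_addNr.

Fact gwa_mulrA : associative gwa_mul.
Proof.
move=> a b c; rewrite -[a]gwa_reprK -[b]gwa_reprK -[c]gwa_reprK.
by gwa_lift gwa_mulA.
Qed.
Fact gwa_mul1 : left_id (gwa_pi (GCoef 1)) gwa_mul.
Proof. by move=> a; rewrite -[a]gwa_reprK; gwa_lift gwa_mul1l. Qed.
Fact gwa_mulr1 : right_id (gwa_pi (GCoef 1)) gwa_mul.
Proof. by move=> a; rewrite -[a]gwa_reprK; gwa_lift gwa_mul1r. Qed.
Fact gwa_mulrDl : left_distributive gwa_mul gwa_add.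
Proof.
move=> a b c; rewrite -[a]gwa_reprK -[b]gwa_reprK -[c]gwa_reprK.
by gwa_lift gwa_mulDl.
Qed.
Fact gwa_mulrDr : right_distributive gwa_mul gwa_add.
Proof.
move=> a b c; rewrite -[a]gwa_reprK -[b]gwa_reprK -[c]gwa_reprK.
by gwa_lift gwa_mulDr.
Qed.
HB.instance Definition _ := GRing.Zmodule_isPzRing.Build gwa
  gwa_mulrA gwa_mul1 gwa_mulr1 gwa_mulrDl gwa_mulrDr.

Definition gwa_coef (r : R) : gwa := gwa_pi (GCoef r).
Definition tplus : gwa := gwa_pi GTplus.
Definition tminus : gwa := gwa_pi GTminus.

Lemma gwa_piD x y : gwa_pi (GAdd x y) = gwa_pi x + gwa_pi y.
Proof. exact: gwa_pi_add. Qed.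
Lemma gwa_piM x y : gwa_pi (GMul x y) = gwa_pi x * gwa_pi y.
Proof. exact: gwa_pi_mul. Qed.

Fact gwa_coef_is_zmod_morphism : zmod_morphism gwa_coef.
Proof.
move=> r s; apply: (addIr (gwa_coef s)); rewrite subrK.
by rewrite /gwa_coef -gwa_piD -[in RHS](subrK s r); apply/gwa_piP/gwa_sym/gwa_coefD.
Qed.
Fact gwa_coef_is_monoid_morphism : monoid_morphism gwa_coef.
Proof.
by split=> // r s; rewrite /gwa_coef -gwa_piM; apply/gwa_piP/gwa_coefM.
Qed.
HB.instance Definition _ :=
  GRing.isZmodMorphism.Build R gwa gwa_coef gwa_coef_is_zmod_morphism.
HB.instance Definition _ :=
  GRing.isMonoidMorphism.Build R gwa gwa_coef gwa_coef_is_monoid_morphism.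

Lemma coef_tplus r : gwa_coef r * tplus = tplus * gwa_coef (sigma r).
Proof. by rewrite -!gwa_piM; apply/gwa_piP/gwa_coef_tplus. Qed.
Lemma coef_tminus r : gwa_coef (sigma r) * tminus = tminus * gwa_coef r.
Proof. by rewrite -!gwa_piM; apply/gwa_piP/gwa_coef_tminus. Qed.
Lemma tminus_tplus : tminus * tplus = gwa_coef (sigma v).
Proof. by rewrite -!gwa_piM; apply/gwa_piP/gwa_tminus_tplus. Qed.
Lemma tplus_tminus : tplus * tminus = gwa_coef v.
Proof. by rewrite -!gwa_piM; apply/gwa_piP/gwa_tplus_tminus. Qed.

Lemma gwa_ind (P : gwa -> Prop) :
  (forall r, P (gwa_coef r)) -> P tplus -> P tminus ->
  (forall a b, P a -> P b -> P (a + b)) ->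
  (forall a b, P a -> P b -> P (a * b)) -> forall a, P a.
Proof.
move=> Pc Pp Pm PD PM a; rewrite -[a]gwa_reprK.
by elim: (gwa_repr a) => // x Px y Py; rewrite ?gwa_piD ?gwa_piM; auto.
Qed.

(* In particular, if R is an algebra over k and sigma is k-linear, then the
   image of k in [gwa] is central: [gwa] is a k-algebra. *)
Lemma gwa_coef_central r : sigma r = r -> forall a, gwa_coef r * a = a * gwa_coef r.
Proof.
move=> sr; apply: gwa_ind => [s|||a b IHa IHb|a b IHa IHb].
- by rewrite -!rmorphM mulrC.
- by rewrite coef_tplus sr.
- by rewrite -{1}sr coef_tminus.
- by rewrite mulrDl mulrDr IHa IHb.
- by rewrite mulrA IHa -mulrA IHb mulrA.
Qed.

Section UniversalProperty.
Variables (B : pzRingType) (f : {rmorphism R -> B}) (bp bm : B).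
Hypothesis fp : forall r, f r * bp = bp * f (sigma r).
Hypothesis fm : forall r, f (sigma r) * bm = bm * f r.
Hypothesis bmp : bm * bp = f (sigma v).
Hypothesis bpm : bp * bm = f v.

Fixpoint gwa_eval (x : gwa_term R) : B :=
  match x with
  | GCoef r => f r
  | GTplus => bp
  | GTminus => bm
  | GAdd x y => gwa_eval x + gwa_eval y
  | GMul x y => gwa_eval x * gwa_eval y
  end.

Lemma gwa_eval_rel x y : gwa_rel x y -> gwa_eval x = gwa_eval y.
Proof.
elim=> //=; do ?[by move=> *; congruence].
- by move=> *; rewrite addrA.
- by move=> *; rewrite addrC.
- by move=> *; rewrite rmorph0 add0r.
- by move=> *; rewrite rmorphN1 mulN1r addNr rmorph0.
- by move=> *; rewrite mulrA.
- by move=> *; rewrite rmorph1 mul1r.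
- by move=> *; rewrite rmorph1 mulr1.
- by move=> *; rewrite mulrDl.
- by move=> *; rewrite mulrDr.
- by move=> *; rewrite rmorphD.
- by move=> *; rewrite rmorphM.
Qed.

Lemma gwa_universal : exists! g : gwa -> B,
  [/\ zmod_morphism g, monoid_morphism g, (forall r, g (gwa_coef r) = f r),
      g tplus = bp & g tminus = bm].
Proof.
pose g a := gwa_eval (gwa_repr a).
have gpi x : g (gwa_pi x) = gwa_eval x.
  by apply: gwa_eval_rel; apply/gwa_piP; rewrite gwa_reprK.
have gD a b : g (a + b) = g a + g b.
  by rewrite -[a]gwa_reprK -[b]gwa_reprK -gwa_piD !gpi.
have gM a b : g (a * b) = g a * g b.
  by rewrite -[a]gwa_reprK -[b]gwa_reprK -gwa_piM !gpi.
exists g; split.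
  split; [|split=> //; by rewrite gpi /= rmorph1| | |]; try by move=> *; rewrite gpi.
  by move=> a b; apply: (addIr (g b)); rewrite subrK -gD subrK.
move=> h [hB [h1 hM] hc hp hm]; apply/funext; apply: gwa_ind.
- by move=> r; rewrite gpi hc.
- by rewrite gpi hp.
- by rewrite gpi hm.
- move=> a b IHa IHb; rewrite gD IHa IHb.
  suff : h a = h (a + b) - h b by move->; rewrite subrK.
  by rewrite -hB addrK.
- by move=> a b IHa IHb; rewrite gM IHa IHb hM.
Qed.

End UniversalProperty.

(* [gwa_homog i a] says that a lies in A_i, for the grading generated by
   deg r = 0, deg t+ = 1, deg t- = -1. *)
Inductive gwa_homog : int -> gwa -> Prop :=
  | homog_coef r : gwa_homog 0 (gwa_coef r)
  | homog_tplus : gwa_homog 1 tplus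
  | homog_tminus : gwa_homog (- 1) tminus
  | homog0 i : gwa_homog i 0
  | homogD i a b : gwa_homog i a -> gwa_homog i b -> gwa_homog i (a + b)
  | homogM i j a b : gwa_homog i a -> gwa_homog j b -> gwa_homog (i + j) (a * b).

End GWA.

Section ImageCokernel.
Variables (A : pzRingType) (M N : lmodType A) (f : {linear M -> N}).

Definition im_pred : {pred N} := fun y => `[< exists x, y = f x >].

Lemma im_predP y : reflect (exists x, y = f x) (y \in im_pred).
Proof. exact: asboolP. Qed.

Fact im_submod_closed : submod_closed im_pred.
Proof.
split; first by apply/im_predP; exists 0; rewrite raddf0.
move=> a _ _ /im_predP[x ->] /im_predP[y ->].
by apply/im_predP; exists (a *: x + y); rewrite linearP.
Qed.
HB.instance Definition _ := GRing.isSubmodClosed.Build A N im_pred im_submod_closed.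

Record im_mod := ImMod { im_val : N; im_valP : im_val \in im_pred }.
HB.instance Definition _ := [isSub for im_val].
HB.instance Definition _ := [Choice of im_mod by <:].
HB.instance Definition _ := [SubChoice_isSubLmodule of im_mod by <:].

Definition coker_mod := Quotient.quot im_pred.
HB.instance Definition _ := GRing.Zmodule.on coker_mod.
Definition coker_pi (y : N) : coker_mod := \pi_(Quotient.quot im_pred) y.
Definition coker_repr (q : coker_mod) : N := repr q.

Lemma coker_reprK q : coker_pi (coker_repr q) = q.
Proof. exact: reprK. Qed.

Lemma coker_piP x y : coker_pi x = coker_pi y <-> exists z, x - y = f z.
Proof.
split=> [/eqmodP|/im_predP xy]; last exact/eqmodP.
by move/im_predP.
Qed.

Fact coker_pi_is_zmod_morphism : zmod_morphism coker_pi.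
Proof. by move=> x y; rewrite /coker_pi raddfB. Qed.
HB.instance Definition _ :=
  GRing.isZmodMorphism.Build N coker_mod coker_pi coker_pi_is_zmod_morphism.

Definition coker_scale (a : A) (q : coker_mod) : coker_mod :=
  coker_pi (a *: coker_repr q).

Lemma coker_scale_pi a y : coker_scale a (coker_pi y) = coker_pi (a *: y).
Proof.
have [z yz] : exists z, coker_repr (coker_pi y) - y = f z.
  by apply/coker_piP; rewrite coker_reprK.
by apply/coker_piP; exists (a *: z); rewrite -scalerBr yz linearZ.
Qed.

Fact coker_scaleA a b q : coker_scale a (coker_scale b q) = coker_scale (a * b) q.
Proof. by rewrite -[q]coker_reprK !coker_scale_pi scalerA. Qed.
Fact coker_scale1 : left_id 1 coker_scale.
Proof. by move=> q; rewrite -[q]coker_reprK !coker_scale_pi scale1r. Qed.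
Fact coker_scaleDr : right_distributive coker_scale +%R.
Proof.
move=> a q r; rewrite -[q]coker_reprK -[r]coker_reprK.
by rewrite -raddfD !coker_scale_pi scalerDr raddfD.
Qed.
Fact coker_scaleDl q : {morph coker_scale^~ q : a b / a + b}.
Proof.
by move=> a b; rewrite -[q]coker_reprK !coker_scale_pi scalerDl raddfD.
Qed.
HB.instance Definition _ := GRing.Zmodule_isLmodule.Build A coker_mod
  coker_scaleA coker_scale1 coker_scaleDr coker_scaleDl.

Fact coker_pi_is_scalable : scalable coker_pi.
Proof. by move=> a y; rewrite -coker_scale_pi. Qed.
HB.instance Definition _ :=
  GRing.isScalable.Build A N coker_mod *:%R coker_pi coker_pi_is_scalable.

End ImageCokernel.

Lemma linear_ext (A : pzRingType) (M N : lmodType A) (f g : {linear M -> N}) :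
  f =1 g -> f = g.
Proof.
case: f g => [f [[cf1] [cf2]]] [g [[cg1] [cg2]]] /= /funext fg.
subst g; do 2 f_equal; f_equal; exact: Prop_irrelevance.
Qed.

Section GradedModules.
Variables (R : comPzRingType) (sigma : ringAut R) (v : R).
Local Notation A := (gwa sigma v).
Local Notation coef := (@gwa_coef R sigma v).
Local Notation tp := (@tplus R sigma v).
Local Notation tm := (@tminus R sigma v).

(* A Z-grading is given by its projections [hcomp i] onto the homogeneous
   components M_i = [set m | hcomp i m = m]. *)
Record gradedModule := GradedModule {
  gcarrier :> lmodType A;
  hcomp : int -> gcarrier -> gcarrier;
  hcomp_zmod_morphism : forall i, zmod_morphism (hcomp i);
  hcompK : forall i j m, hcomp i (hcomp j m) = if i == j then hcomp j m else 0;
  hcomp_finite : forall m, finite_set [set i | hcomp i m != 0];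
  hcomp_sum : forall m, m = \sum_(i \in [set: int]) hcomp i m;
  hcompZ : forall i j a m, gwa_homog i a ->
    hcomp (i + j) (a *: m) = a *: hcomp j m
}.

Definition homogeneous (M : gradedModule) (i : int) (m : M) : Prop :=
  hcomp i m = m.

Definition locally_nilpotent (M : lmodType A) : Prop :=
  forall m : M, exists k : nat, forall n : nat, (k <= n)%N -> tm ^+ n *: m = 0.

Lemma fsum_seq (V : zmodType) (F : int -> V) (s : seq int) :
  uniq s -> (forall i, i \notin s -> F i = 0) ->
  \sum_(i \in [set: int]) F i = \sum_(i <- s) F i.
Proof.
move=> us F0; rewrite (fsbigE s) //; last by move=> i _; apply: F0.
by apply: eq_bigl => i; rewrite in_setT.
Qed.

Lemma fsum_finite (V : zmodType) (F : int -> V) (s : seq int) :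
  (forall i, i \notin s -> F i = 0) -> finite_set [set i | F i != 0].
Proof.
move=> F0; apply: (@sub_finite_set _ _ [set` s]); last exact: finite_seq.
by move=> i /= /eqP Fi; apply: contrapT => /negP si; apply: Fi; apply: F0.
Qed.

Section GradedModuleTheory.
Variable M : gradedModule.

Lemma hcompB i : {morph hcomp (g := M) i : x y / x - y}.
Proof. exact: hcomp_zmod_morphism. Qed.
Lemma hcomp0 i : hcomp i (0 : M) = 0.
Proof. by have := hcompB i 0 0; rewrite !subrr. Qed.
Lemma hcompN i : {morph hcomp (g := M) i : x / - x}.
Proof. by move=> x; rewrite -sub0r hcompB hcomp0 sub0r. Qed.
Lemma hcompD i : {morph hcomp (g := M) i : x y / x + y}.
Proof. by move=> x y; rewrite -{1}[y]opprK hcompB hcompN opprK. Qed.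
Lemma hcomp_bigsum i (I : Type) (s : seq I) (F : I -> M) :
  hcomp i (\sum_(j <- s) F j) = \sum_(j <- s) hcomp i (F j).
Proof. exact: (big_morph _ (hcompD i) (hcomp0 i)). Qed.

Lemma hcomp_seq (m : M) : exists s : seq int,
  [/\ uniq s, forall i, i \notin s -> hcomp i m = 0 & m = \sum_(i <- s) hcomp i m].
Proof.
have /finite_seqP[s' s'E] := hcomp_finite m.
have F0 i : i \notin undup s' -> hcomp i m = 0.
  rewrite mem_undup => si; apply: contrapT => /eqP mi.
  by move: si; apply/negP; rewrite negbK; have : [set` s'] i by rewrite -s'E.
exists (undup s'); split=> //; first exact: undup_uniq.
by rewrite {1}[m]hcomp_sum; apply: fsum_seq F0; apply: undup_uniq.
Qed.

Lemma hcomp_ext (x y : M) : (forall i, hcomp i x = hcomp i y) -> x = y.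
Proof.
move=> xy; rewrite [x]hcomp_sum [y]hcomp_sum.
by apply: eq_fsbigr => i _.
Qed.

(* x . r is the sum over i of sigma^{-i}(r) x_i *)
Definition ract (r : R) (x : M) : M :=
  \sum_(i \in [set: int]) coef (aut_pow sigma (- i) r) *: hcomp i x.

Definition ann : set R := [set r | forall x : M, ract r x = 0].

Definition supp : set (Spec R) := [set p : Spec R | ann `<=` spec_ideal p].

(* The class of [e] in R / ann(M) is the idempotent 1_W, that is, the
   idempotent lying outside exactly the points of supp(M) which belong to W. *)
Definition lifts_idempotent (W : set (Spec R)) (e : R) : Prop :=
  ann (e * e - e) /\ forall p, supp p -> (W p <-> ~ spec_ideal p e).

(* Some lift of 1_W; it exists if W is open and closed in supp(M). *)
Definition idempotent_lift (W : set (Spec R)) : R :=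
  xget 0 [set e | lifts_idempotent W e].

Lemma ractE r (x : M) i : hcomp i (ract r x) = coef (aut_pow sigma (- i) r) *: hcomp i x.
Proof.
have [s [us F0 _]] := hcomp_seq x.
rewrite /ract (fsum_seq us) => [|j /F0 ->]; last by rewrite scaler0.
have Z j k : hcomp j (coef (aut_pow sigma (- k) r) *: hcomp k x)
    = if j == k then coef (aut_pow sigma (- k) r) *: hcomp k x else 0.
  rewrite -[j in hcomp j]add0r hcompZ; last exact: homog_coef.
  by rewrite hcompK; case: eqP => // _; rewrite scaler0.
rewrite hcomp_bigsum (eq_bigr _ (fun j _ => Z i j)).
have [si|si] := boolP (i \in s).
  rewrite (bigD1_seq i) //= eqxx big1 ?addr0 // => j /negPf.
  by rewrite eq_sym => ->.
rewrite F0 // scaler0 big_seq big1 // => j sj; case: eqP => // ij.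
by rewrite ij sj in si.
Qed.

Lemma aut_powDS (i : int) r : aut_pow sigma (i + 1) r = sigma (aut_pow sigma i r).
Proof.
case: i => [n|[|n]]; first by rewrite -PoszD addn1.
  by rewrite /aut_pow /= autVK.
have -> : Negz n.+1 + 1 = Negz n by rewrite !NegzE -[n.+2]addn1 PoszD opprD subrK.
by rewrite /aut_pow /= autVK.
Qed.

Lemma ractD r : {morph ract r : x y / x + y}.
Proof. by move=> x y; apply: hcomp_ext => i; rewrite hcompD !ractE hcompD scalerDr. Qed.

Lemma ract_scale r (a : A) x : ract r (a *: x) = a *: ract r x.
Proof.
move: a x; apply: gwa_ind => [s x|x|x|a b IHa IHb x|a b IHa IHb x].
- apply: hcomp_ext => i; rewrite ractE -[i in hcomp i]add0r.
  rewrite !hcompZ ?ractE; do ?exact: homog_coef.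
  by rewrite !scalerA -!rmorphM mulrC.
- apply: hcomp_ext => i; have -> : i = 1 + (i - 1) by rewrite addrC subrK.
  move: (i - 1) => j; have e : - (1 + j) + 1 = - j by rewrite opprD addrAC addNr add0r.
  rewrite ractE !(hcompZ _ _ (homog_tplus sigma v)) ractE.
  by rewrite !scalerA coef_tplus -aut_powDS e.
- apply: hcomp_ext => i; have -> : i = -1 + (i + 1) by rewrite addrC addrK.
  move: (i + 1) => j; have e : - (-1 + j) = - j + 1 by rewrite opprD opprK addrC.
  rewrite ractE !(hcompZ _ _ (homog_tminus sigma v)) ractE.
  by rewrite !scalerA e aut_powDS coef_tminus.
- by rewrite !scalerDl ractD IHa IHb.
- by rewrite -!scalerA IHa IHb.
Qed.

End GradedModuleTheory.

(* The action of A on A-valued functions on Z (formal sums of homogeneous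
   components) in which t+ and t- also shift the index; acting on the unit,
   placed in degree 0, computes homogeneous components. *)
Fixpoint term_act (x : gwa_term R) (F : int -> A) : int -> A :=
  match x with
  | GCoef r => fun i => coef r * F i
  | GTplus => fun i => tp * F (i - 1)
  | GTminus => fun i => tm * F (i + 1)
  | GAdd x y => fun i => term_act x F i + term_act y F i
  | GMul x y => term_act x (term_act y F)
  end.

Lemma term_actD x F G :
  term_act x (fun i => F i + G i) = (fun i => term_act x F i + term_act x G i).
Proof.
elim: x F G => [r|||x IHx y IHy|x IHx y IHy] F G /=.
- by apply/funext => i; rewrite mulrDr.
- by apply/funext => i; rewrite mulrDr.
- by apply/funext => i; rewrite mulrDr.
- by apply/funext => i; rewrite IHx IHy addrACA.
- by rewrite IHy IHx.
Qed.

Lemma term_act_rel x y : gwa_rel sigma v x y -> term_act x = term_act y.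
Proof.
elim=> //= {x y}; do ?[by move=> *; apply/funext => F; congruence];
  move=> *; apply/funext => F; apply/funext => i.
- by do 2 match goal with H : term_act _ = term_act _ |- _ => rewrite {}H end.
- by rewrite addrA.
- by rewrite addrC.
- by rewrite rmorph0 mul0r add0r.
- by rewrite rmorphN1 mulN1r addNr rmorph0 mul0r.
- by rewrite rmorph1 mul1r.
- by congr (term_act _ _ _); apply/funext => j; rewrite rmorph1 mul1r.
- by rewrite term_actD.
- by rewrite rmorphD mulrDl.
- by rewrite rmorphM mulrA.
- by rewrite !mulrA coef_tplus.
- by rewrite !mulrA coef_tminus.
- by rewrite mulrA tminus_tplus addrK.
- by rewrite mulrA tplus_tminus subrK.
Qed.

Definition gwa_act (a : A) : (int -> A) -> int -> A := term_act (gwa_repr a).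

Lemma gwa_act_pi x : gwa_act (gwa_pi sigma v x) = term_act x.
Proof. by apply: term_act_rel; apply/gwa_piP; rewrite gwa_reprK. Qed.
Lemma gwa_act_coef r F i : gwa_act (coef r) F i = coef r * F i.
Proof. by rewrite gwa_act_pi. Qed.
Lemma gwa_actD a b F i : gwa_act (a + b) F i = gwa_act a F i + gwa_act b F i.
Proof. by rewrite -[a]gwa_reprK -[b]gwa_reprK -gwa_piD !gwa_act_pi. Qed.
Lemma gwa_actM a b F : gwa_act (a * b) F = gwa_act a (gwa_act b F).
Proof. by rewrite -[a]gwa_reprK -[b]gwa_reprK -gwa_piM !gwa_act_pi. Qed.
Lemma gwa_act0 F i : gwa_act 0 F i = 0.
Proof. by rewrite -(rmorph0 (@gwa_coef R sigma v)) gwa_act_coef rmorph0 mul0r. Qed.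

Lemma gwa_act_homog d a : gwa_homog d a ->
  forall F i, gwa_act a F i = a * F (i - d).
Proof.
elim=> {d a} [r|||d|d a b _ IHa _ IHb|d e a b _ IHa _ IHb] F i.
- by rewrite gwa_act_coef subr0.
- by rewrite gwa_act_pi.
- by rewrite gwa_act_pi opprK.
- by rewrite gwa_act0 mul0r.
- by rewrite gwa_actD IHa IHb mulrDl.
- by rewrite gwa_actM IHa IHb mulrA opprD addrA.
Qed.

Definition gwa_unit (i : int) : A := if i == 0 then 1 else 0.
Definition gwa_hcomp (i : int) (a : A^o) : A^o := gwa_act a gwa_unit i.

Lemma gwa_homog_eq d e (a : A) : gwa_homog d a -> d = e -> gwa_homog e a.
Proof. by move=> ? <-. Qed.

Lemma gwa_act_homog_fun a F : (forall j, gwa_homog j (F j)) ->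
  forall j, gwa_homog j (gwa_act a F j).
Proof.
move: a F; apply: gwa_ind => [r|||a b IHa IHb|a b IHa IHb] F HF j.
- by rewrite gwa_act_coef -[j]add0r; apply: homogM; [exact: homog_coef|rewrite add0r].
- rewrite gwa_act_pi /=; apply: gwa_homog_eq (homogM (homog_tplus _ _) (HF _)) _.
  by rewrite addrC subrK.
- rewrite gwa_act_pi /=; apply: gwa_homog_eq (homogM (homog_tminus _ _) (HF _)) _.
  by rewrite addrC addrK.
- by rewrite gwa_actD; apply: homogD; [apply: IHa|apply: IHb].
- by rewrite gwa_actM; apply: IHa; apply: IHb.
Qed.

Lemma gwa_unit_homog j : gwa_homog j (gwa_unit j).
Proof.
rewrite /gwa_unit; case: eqP => [->|_]; last exact: homog0.
by rewrite -(rmorph1 (@gwa_coef R sigma v)); exact: homog_coef.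
Qed.

Lemma gwa_hcomp_homog i a : gwa_homog i (gwa_hcomp i a).
Proof. exact: gwa_act_homog_fun gwa_unit_homog _. Qed.

Lemma homog_gwa_hcomp i j (a : A) :
  gwa_homog j a -> gwa_hcomp i a = if i == j then a else 0.
Proof.
move=> Ha; rewrite /gwa_hcomp (gwa_act_homog Ha) /gwa_unit subr_eq0.
by case: eqP; rewrite ?mulr1 ?mulr0.
Qed.

Lemma gwa_decomp (a : A) : exists2 s : seq (int * A),
  (forall p, p \in s -> gwa_homog p.1 p.2) & a = \sum_(p <- s) p.2.
Proof.
move: a; apply: gwa_ind => [r|||a b [s Hs ->] [t Ht ->]|a b [s Hs ->] [t Ht ->]].
- exists [:: (0, coef r)]; last by rewrite big_seq1.
  by move=> p; rewrite inE => /eqP ->; exact: homog_coef.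
- exists [:: (1, tp)]; last by rewrite big_seq1.
  by move=> p; rewrite inE => /eqP ->; exact: homog_tplus.
- exists [:: (-1, tm)]; last by rewrite big_seq1.
  by move=> p; rewrite inE => /eqP ->; exact: homog_tminus.
- exists (s ++ t); last by rewrite big_cat.
  by move=> p; rewrite mem_cat => /orP[/Hs|/Ht].
- exists [seq (p.1 + q.1, p.2 * q.2) | p <- s, q <- t].
    by move=> _ /allpairsP[[p q] /= [/Hs Hp /Ht Hq ->]]; exact: homogM.
  rewrite big_allpairs_dep /= mulr_suml; apply: eq_bigr => p _.
  by rewrite mulr_sumr.
Qed.

Fact gwa_hcomp_zmod_morphism i : zmod_morphism (gwa_hcomp i).
Proof.
move=> a b; apply: (addIr (gwa_hcomp i b)).
by rewrite subrK /gwa_hcomp -gwa_actD subrK.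
Qed.

Fact gwa_hcompK i j a :
  gwa_hcomp i (gwa_hcomp j a) = if i == j then gwa_hcomp j a else 0.
Proof. exact/homog_gwa_hcomp/gwa_hcomp_homog. Qed.

Lemma gwa_hcomp_seq (a : A) : exists s : seq int,
  [/\ uniq s, forall i, i \notin s -> gwa_hcomp i a = 0
    & a = \sum_(i <- s) gwa_hcomp i a].
Proof.
have [s Hs aE] := gwa_decomp a.
have hE i : gwa_hcomp i a = \sum_(p <- s) if i == p.1 then p.2 else 0.
  have h0 : gwa_hcomp i 0 = 0 by exact: gwa_act0.
  rewrite {1}aE (big_morph (gwa_hcomp i) (fun x y => gwa_actD x y _ i) h0).
  by apply: eq_big_seq => p /Hs /homog_gwa_hcomp ->.
exists (undup (map fst s)); split; first exact: undup_uniq.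
  move=> i; rewrite mem_undup hE => si; rewrite big_seq big1 // => p ps.
  by case: eqP => // ip; move: si; rewrite ip map_f.
under eq_bigr do rewrite hE.
rewrite exchange_big /= {1}aE; apply: eq_big_seq => p ps.
rewrite (bigD1_seq p.1) ?undup_uniq ?mem_undup ?map_f //= eqxx.
by rewrite big1 ?addr0 // => j /negPf ->.
Qed.

Fact gwa_hcomp_finite a : finite_set [set i | gwa_hcomp i a != 0].
Proof. by have [s [_ s0 _]] := gwa_hcomp_seq a; exact: fsum_finite s0. Qed.

Fact gwa_hcomp_sum a : a = \sum_(i \in [set: int]) gwa_hcomp i a.
Proof. by have [s [us s0 aE]] := gwa_hcomp_seq a; rewrite (fsum_seq us s0). Qed.

Fact gwa_hcompZ i j a (m : A^o) : gwa_homog i a ->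
  gwa_hcomp (i + j) (a *: m) = a *: gwa_hcomp j m.
Proof.
by move=> Ha; rewrite /gwa_hcomp gwa_actM (gwa_act_homog Ha) addrAC subrr add0r.
Qed.

Definition gwa_regular : gradedModule :=
  @GradedModule A^o gwa_hcomp gwa_hcomp_zmod_morphism gwa_hcompK
    gwa_hcomp_finite gwa_hcomp_sum gwa_hcompZ.

Lemma sum_of_seq (V : zmodType) (m : V) (F : int -> V) (s : seq int) :
  uniq s -> (forall i, i \notin s -> F i = 0) -> m = \sum_(i <- s) F i ->
  m = \sum_(i \in [set: int]) F i.
Proof. by move=> us F0 ->; rewrite (fsum_seq us F0). Qed.

Section GradedImageCokernel.
Variables (M : lmodType A) (N : gradedModule) (f : {linear M -> N}).
Hypothesis f_graded : forall i x, exists y, hcomp i (f x) = f y.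

Fact im_hcomp_subproof i (y : im_mod f) : hcomp i (val y) \in im_pred f.
Proof.
have /im_predP[x ->] := valP y; apply/im_predP; exact: f_graded.
Qed.

Definition im_hcomp i (y : im_mod f) : im_mod f := ImMod (im_hcomp_subproof i y).

Fact im_hcomp_zmod_morphism i : zmod_morphism (im_hcomp i).
Proof.
move=> x y; apply: val_inj; rewrite raddfB /=.
by rewrite -hcompB; congr (hcomp i _); exact: raddfB.
Qed.
Fact im_hcompK i j y :
  im_hcomp i (im_hcomp j y) = if i == j then im_hcomp j y else 0.
Proof. by apply: val_inj; rewrite /= hcompK; case: eqP. Qed.
Lemma im_hcomp_seq y : exists s : seq int,
  [/\ uniq s, forall i, i \notin s -> im_hcomp i y = 0
    & y = \sum_(i <- s) im_hcomp i y].
Proof.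
have [s [us s0 yE]] := hcomp_seq (val y : N); exists s; split=> //.
  by move=> i /s0 yi0; apply: val_inj.
by apply: val_inj; rewrite raddf_sum.
Qed.
Fact im_hcomp_finite y : finite_set [set i | im_hcomp i y != 0].
Proof. by have [s [_ s0 _]] := im_hcomp_seq y; exact: fsum_finite s0. Qed.
Fact im_hcomp_sum y : y = \sum_(i \in [set: int]) im_hcomp i y.
Proof. by have [s [us s0 yE]] := im_hcomp_seq y; exact: sum_of_seq us s0 yE. Qed.
Fact im_hcompZ i j a y : gwa_homog i a ->
  im_hcomp (i + j) (a *: y) = a *: im_hcomp j y.
Proof.
move=> Ha; apply: val_inj; rewrite linearZ /= -(hcompZ _ _ Ha).
by congr (hcomp _ _); exact: (linearZ val).
Qed.

Definition graded_im : gradedModule :=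
  @GradedModule (im_mod f) im_hcomp im_hcomp_zmod_morphism im_hcompK
    im_hcomp_finite im_hcomp_sum im_hcompZ.

Definition coker_hcomp i (q : coker_mod f) : coker_mod f :=
  coker_pi f (hcomp i (coker_repr q)).

Lemma coker_hcomp_pi i y : coker_hcomp i (coker_pi f y) = coker_pi f (hcomp i y).
Proof.
have [z yz] : exists z, coker_repr (coker_pi f y) - y = f z.
  by apply/coker_piP; rewrite coker_reprK.
have [w zw] := f_graded i z.
by apply/coker_piP; exists w; rewrite -hcompB yz.
Qed.

Fact coker_hcomp_zmod_morphism i : zmod_morphism (coker_hcomp i).
Proof.
move=> x y; rewrite -[x]coker_reprK -[y]coker_reprK -raddfB.
by rewrite !coker_hcomp_pi hcompB raddfB.
Qed.
Fact coker_hcompK i j q :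
  coker_hcomp i (coker_hcomp j q) = if i == j then coker_hcomp j q else 0.
Proof.
rewrite -[q]coker_reprK !coker_hcomp_pi hcompK.
by case: eqP => // _; rewrite raddf0.
Qed.
Lemma coker_hcomp_seq q : exists s : seq int,
  [/\ uniq s, forall i, i \notin s -> coker_hcomp i q = 0
    & q = \sum_(i <- s) coker_hcomp i q].
Proof.
have [s [us s0 yE]] := hcomp_seq (coker_repr q : N); exists s; split=> //.
  by move=> i /s0 yi0; rewrite /coker_hcomp yi0 raddf0.
by rewrite -{1}[q]coker_reprK {1}yE raddf_sum.
Qed.
Fact coker_hcomp_finite q : finite_set [set i | coker_hcomp i q != 0].
Proof. by have [s [_ s0 _]] := coker_hcomp_seq q; exact: fsum_finite s0. Qed.
Fact coker_hcomp_sum q : q = \sum_(i \in [set: int]) coker_hcomp i q.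
Proof. by have [s [us s0 qE]] := coker_hcomp_seq q; exact: sum_of_seq us s0 qE. Qed.
Fact coker_hcompZ i j a q : gwa_homog i a ->
  coker_hcomp (i + j) (a *: q) = a *: coker_hcomp j q.
Proof.
move=> Ha; rewrite -[q]coker_reprK -linearZ !coker_hcomp_pi.
by rewrite hcompZ // linearZ.
Qed.

Definition graded_coker : gradedModule :=
  @GradedModule (coker_mod f) coker_hcomp coker_hcomp_zmod_morphism coker_hcompK
    coker_hcomp_finite coker_hcomp_sum coker_hcompZ.

End GradedImageCokernel.

(* M[n]_i = M_{i+n} *)
Section Shift.
Variables (M : gradedModule) (n : int).

Definition gshift_hcomp (i : int) : M -> M := hcomp (i + n).

Fact gshift_hcomp_zmod_morphism i : zmod_morphism (gshift_hcomp i).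
Proof. exact: hcompB. Qed.
Fact gshift_hcompK i j m :
  gshift_hcomp i (gshift_hcomp j m) = if i == j then gshift_hcomp j m else 0.
Proof. by rewrite /gshift_hcomp hcompK (inj_eq (addIr n)). Qed.
Lemma gshift_hcomp_seq m : exists s : seq int,
  [/\ uniq s, forall i, i \notin s -> gshift_hcomp i m = 0
    & m = \sum_(i <- s) gshift_hcomp i m].
Proof.
have [s [us s0 mE]] := hcomp_seq m; exists [seq i - n | i <- s]; split.
- by rewrite map_inj_uniq //; exact: addIr.
- move=> i si; apply: s0; apply: contra si => si.
  by apply/mapP; exists (i + n); rewrite ?addrK.
- rewrite big_map {1}mE; apply: eq_bigr => i _.
  by rewrite /gshift_hcomp subrK.
Qed.
Fact gshift_hcomp_finite m : finite_set [set i | gshift_hcomp i m != 0].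
Proof. by have [s [_ s0 _]] := gshift_hcomp_seq m; exact: fsum_finite s0. Qed.
Fact gshift_hcomp_sum m : m = \sum_(i \in [set: int]) gshift_hcomp i m.
Proof. by have [s [us s0 mE]] := gshift_hcomp_seq m; exact: sum_of_seq us s0 mE. Qed.
Fact gshift_hcompZ i j a m : gwa_homog i a ->
  gshift_hcomp (i + j) (a *: m) = a *: gshift_hcomp j m.
Proof. by move=> Ha; rewrite /gshift_hcomp -addrA hcompZ. Qed.

Definition gshift : gradedModule :=
  @GradedModule M gshift_hcomp gshift_hcomp_zmod_morphism gshift_hcompK
    gshift_hcomp_finite gshift_hcomp_sum gshift_hcompZ.

End Shift.

Section Summand.
Variables (M : gradedModule) (W : set (Spec R)).

Definition act_idempotent (x : M) : M := ract (idempotent_lift M W) x.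

Fact act_idempotent_zmod_morphism : zmod_morphism act_idempotent.
Proof.
move=> x y; apply: (addIr (act_idempotent y)).
by rewrite subrK /act_idempotent -ractD subrK.
Qed.
HB.instance Definition _ :=
  GRing.isZmodMorphism.Build M M act_idempotent act_idempotent_zmod_morphism.
Fact act_idempotent_scalable : scalable act_idempotent.
Proof. by move=> a x; exact: ract_scale. Qed.
HB.instance Definition _ :=
  GRing.isScalable.Build A M M *:%R act_idempotent act_idempotent_scalable.

Fact act_idempotent_graded i x :
  exists y, hcomp i (act_idempotent x) = act_idempotent y.
Proof.
exists (hcomp i x); apply: hcomp_ext => j.
rewrite hcompK [in RHS]ractE hcompK; case: eqP => [->|_]; first by rewrite ractE.
by rewrite scaler0.
Qed.

(* M_W = M . 1_W *)
Definition summand : gradedModule := graded_im act_idempotent_graded.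

Lemma summand_nilpotent : locally_nilpotent M -> locally_nilpotent summand.
Proof.
move=> nilM y; have [k kP] := nilM (val y); exists k => n /kP yn0.
by apply: val_inj; rewrite linearZ.
Qed.

End Summand.

Section Amod.
Variable n : nat.

Definition mul_tminus (a : A^o) : A^o := a * tm ^+ n.

Fact mul_tminus_zmod_morphism : zmod_morphism mul_tminus.
Proof. by move=> a b; rewrite /mul_tminus mulrBl. Qed.
HB.instance Definition _ :=
  GRing.isZmodMorphism.Build A^o A^o mul_tminus mul_tminus_zmod_morphism.
Fact mul_tminus_scalable : scalable mul_tminus.
Proof. by move=> a b; apply/esym/mulrA. Qed.
HB.instance Definition _ :=
  GRing.isScalable.Build A A^o A^o *:%R mul_tminus mul_tminus_scalable.

Lemma homog_tminusX k : gwa_homog (- k%:Z) (tm ^+ k).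
Proof.
elim: k => [|k IHk].
  by rewrite expr0 -(rmorph1 (@gwa_coef R sigma v)) oppr0; exact: homog_coef.
rewrite exprS; apply: gwa_homog_eq (homogM (homog_tminus _ _) IHk) _.
by rewrite -opprD -PoszD.
Qed.

Fact mul_tminus_graded i x : exists y,
  hcomp (g := gwa_regular) i (mul_tminus x) = mul_tminus y.
Proof.
have [s Hs ->] := gwa_decomp x.
exists (\sum_(p <- s) if i == p.1 - n%:Z then p.2 else 0).
rewrite [mul_tminus _ in LHS]mulr_suml [RHS]mulr_suml.
rewrite (hcomp_bigsum (M := gwa_regular)); apply: eq_big_seq => p /Hs Hp.
rewrite [LHS](homog_gwa_hcomp _ (homogM Hp (homog_tminusX n))).
by case: eqP => // _; rewrite mul0r.
Qed.

(* A(n) = A / A t-^n *)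
Definition Amod : gradedModule :=
  @graded_coker A^o gwa_regular mul_tminus mul_tminus_graded.

Lemma tminusX_coef k r : exists s, tm ^+ k * coef r = coef s * tm ^+ k.
Proof.
elim: k r => [|k IHk] r; first by exists r; rewrite expr0 mul1r mulr1.
have [s sE] := IHk (sigma r); exists s.
by rewrite exprSr -mulrA -coef_tminus mulrA sE mulrA.
Qed.

Lemma tminusX_absorb (a : A) (l : nat) : exists k, forall m, (k <= m)%N ->
  exists b, tm ^+ m * a = b * tm ^+ l.
Proof.
move: a l; apply: gwa_ind => [r l|l|l|a b IHa IHb l|a b IHa IHb l].
- exists l => m lm; have [s ->] := tminusX_coef m r.
  by exists (coef s * tm ^+ (m - l)); rewrite -mulrA -exprD subnK.
- exists l.+1 => -[//|m] lm; rewrite exprSr -mulrA tminus_tplus.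
  have [s ->] := tminusX_coef m (sigma v).
  by exists (coef s * tm ^+ (m - l)); rewrite -mulrA -exprD subnK.
- exists l => m lm; exists (tm ^+ (m - l).+1).
  by rewrite -exprSr -exprD addSn subnK.
- have [k kP] := IHa l; have [k' kP'] := IHb l; exists (maxn k k') => m.
  rewrite geq_max => /andP[/kP[c cE] /kP'[d dE]].
  by exists (c + d); rewrite mulrDr cE dE mulrDl.
- have [k kP] := IHb l; have [k' kP'] := IHa k; exists k' => m /kP'[c cE].
  have [d dE] := kP k (leqnn k).
  by exists (c * d); rewrite mulrA cE -mulrA dE mulrA.
Qed.

Lemma Amod_nilpotent : locally_nilpotent Amod.
Proof.
move=> q; rewrite -[q]coker_reprK; set a := coker_repr q.
have [k kP] := tminusX_absorb a n; exists k => m /kP[b bE].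
rewrite -linearZ -(raddf0 (coker_pi (mul_tminus : {linear A^o -> A^o}))).
by apply/coker_piP; exists b; rewrite subr0.
Qed.

End Amod.

Record grHom (M N : gradedModule) := GrHom {
  gr_fun :> {linear M -> N};
  gr_homogeneous : forall i x, homogeneous i x -> homogeneous i (gr_fun x)
}.

Lemma grHom_ext (M N : gradedModule) (f g : grHom M N) : f =1 g -> f = g.
Proof.
case: f g => [f fP] [g gP] /= /linear_ext fg; subst g.
by congr GrHom; exact: Prop_irrelevance.
Qed.

Definition gr_id (M : gradedModule) : grHom M M :=
  @GrHom M M (idfun : {linear M -> M}) (fun i x => id).

Fact gr_comp_subproof (L M N : gradedModule) (g : grHom M N) (f : grHom L M) i x :
  homogeneous i x -> homogeneous i ((g \o f) x).
Proof. by move=> /(gr_homogeneous f) /(gr_homogeneous g). Qed.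

Definition gr_comp (L M N : gradedModule) (g : grHom M N) (f : grHom L M) :
  grHom L N := @GrHom L N (g \o f : {linear L -> N}) (gr_comp_subproof g f).

Record OplusObj := OplusObject {
  Oplus_module :> gradedModule;
  Oplus_nilpotent : locally_nilpotent Oplus_module
}.

Definition Oplus : category.
Proof.
refine (@Category OplusObj (fun M N => grHom M N) (fun M => gr_id M)
  (fun L M N g f => gr_comp g f) _ _ _); by move=> *; apply: grHom_ext.
Defined.

Record OObj := OObject {
  O_module :> lmodType A;
  O_nilpotent : locally_nilpotent O_module
}.

Definition Ocat : category.
Proof.
refine (@Category OObj (fun M N => {linear M -> N}) (fun M => idfun : {linear M -> M})
  (fun L M N g f => g \o f : {linear L -> N}) _ _ _); by move=> *; apply: linear_ext.
Defined.

Definition forget_grading (M : OplusObj) : OObj := @OObject M (@Oplus_nilpotent M).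

Fact Oshift_nilpotent (M : OplusObj) (n : int) : locally_nilpotent (gshift M n).
Proof. exact: (@Oplus_nilpotent M). Qed.
Definition Oshift (M : OplusObj) (n : int) : OplusObj :=
  @OplusObject (gshift M n) (@Oshift_nilpotent M n).

(* [Amod N] is A(N); this is P_W once N is large enough for W. *)
Definition PW (W : set (Spec R)) (N : nat) : OplusObj :=
  @OplusObject (summand (Amod N) W) (@summand_nilpotent (Amod N) W (@Amod_nilpotent N)).

End GradedModules.

(* Main.v *)
Require Import Defs.
From HB Require Import structures.
From mathcomp Require Import all_boot all_order all_algebra.
From mathcomp Require Import complex ring.
From mathcomp Require Import all_classical all_reals topology.

Set Implicit Arguments.
Unset Strict Implicit.
Unset Printing Implicit Defensive.

Import GRing.Theory.

Local Open Scope classical_set_scope.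
Local Open Scope ring_scope.

(** The module [PW W N] is generated by the idempotent [1_W], so a map from it to
[M] is a vector of [M] killed by [tminus ^+ N] and fixed by [1_W]
([weight_vector], [exists_PW_map], [PW_gen_span]).  In a locally nilpotent
module such vectors are produced from arbitrary ones: if [tminus ^+ k] kills [x]
with [k >= N], the idempotent [e] of [W] for [Amod k] turns [x] into a weight
vector, and it fixes the weight vectors of any module ([weight_vector_proj],
[weight_vector_fixed]).  This is the independence of [P_W] from the exponent: the
kernel of [Amod k -> Amod N] is supported on translates of [Z] which avoid [W], so
[e] kills it ([tminusX_idempotent_lift]).

Projectivity follows, because epimorphisms are surjective (compare the cokernel map
with zero) and the preimage of a weight vector can be corrected by [e] without
changing its image.  For generation, let [d x <> 0] for a difference [d] of two
maps.  Applying a power of [tminus] one may assume that [y = d x] is nonzero and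
killed by [tminus], hence by [v].  A prime over the annihilator of [y] lies on a
component [W] of [Z], and [e] lies outside that prime; so [e x] is a weight vector
with [d (e x) = e y <> 0] ([weight_vector_separate]).

The idempotents exist for all exponents because [R] is Noetherian, by Hilbert's
basis theorem ([noetherian_poly], [noetherian_fg_algebra]): components of closed
sets are then relatively open ([component_clopen]), and the condition on the
translates makes [W] a full component of each translate of [Z] that it meets
([component_translate]), so that [W] is open and closed in the support of
[Amod k].  A partition of the zeros of an ideal into two closed sets comes from an
idempotent modulo that ideal, not only modulo its radical ([exists_idempotent]).

The annihilator of [Amod k] is the set of [r] with [coef r] in [A tminus^k]
([ann_AmodP]).  It contains a product of translates of [v], so the primes over it
lie on these translates, where [W] can be split off. *)

(** * Noetherian rings *)

Record is_ideal (R : comPzRingType) (I : set R) : Prop := IsIdeal {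
  ideal0 : I 0;
  idealD : forall x y, I x -> I y -> I (x + y);
  idealMl : forall a x, I x -> I (a * x)
}.

Lemma idealB (R : comPzRingType) (I : set R) : is_ideal I ->
  forall x y, I x -> I y -> I (x - y).
Proof. by move=> iI x y Ix Iy; rewrite -mulN1r; apply/(idealD iI)/(idealMl iI). Qed.

Lemma ideal1 (R : comPzRingType) (I : set R) : is_ideal I -> I 1 -> forall x, I x.
Proof. by move=> iI I1 x; rewrite -[x]mulr1; apply: idealMl. Qed.

Lemma is_ideal_prime (R : comPzRingType) (p : Spec R) : is_ideal (spec_ideal p).
Proof.
have pp := spec_prime p; split; first exact: prime_ideal0.
- exact: prime_idealD.
- exact: prime_idealMr.
Qed.

(** The maximality condition is the form of the Noetherian property that every
later argument consumes: maximal elements give the primes and the minimal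
clopen sets directly, without chains or dependent choice. *)
Definition noetherian (R : comPzRingType) : Prop :=
  forall F : set (set R), (forall I, F I -> is_ideal I) -> F !=set0 ->
    exists2 I, F I & forall J, F J -> I `<=` J -> J `<=` I.

Lemma noetherian_field (k : fieldType) : noetherian k.
Proof.
move=> F iF [I0 FI0].
have [[I FI I1]|no1] := pselect (exists2 I, F I & I 1).
  by exists I => // J _ _ x _; apply: ideal1 (iF _ FI) I1 x.
exists I0 => // J FJ _ x Jx; have [->|x0] := eqVneq x 0.
  exact: ideal0 (iF _ FI0).
case: no1; exists J => //; rewrite -(mulVf x0).
exact: idealMl (iF _ FJ) _ _ Jx.
Qed.

Lemma noetherian_surj (B R : comPzRingType) (f : {rmorphism B -> R}) :
  (forall r, exists b, f b = r) -> noetherian B -> noetherian R.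
Proof.
move=> fsurj nB F iF [I0 FI0].
have [||_ [I FI <-] Imax] := nB [set f @^-1` I | I in F].
- move=> _ [I /iF iI <-]; split=> /= [|x y|a x].
  + by rewrite rmorph0; apply: ideal0.
  + by rewrite rmorphD; apply: idealD.
  + by rewrite rmorphM; apply: idealMl.
- by exists (f @^-1` I0), I0.
exists I => // J FJ IJ r; have [b <-] := fsurj r.
apply: (Imax (f @^-1` J)); first by exists J.
by move=> x /=; apply: IJ.
Qed.

(** Bounding the size, instead of fixing it, keeps zero in the set, so that it is an
ideal, and makes it grow with [d]. *)
Definition lead_ideal (B : comNzRingType) (I : set {poly B}) (d : nat) : set B :=
  [set a | exists2 p : {poly B}, I p & (size p <= d.+1)%N /\ p`_d = a].

Lemma is_ideal_lead (B : comNzRingType) (I : set {poly B}) d :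
  is_ideal I -> is_ideal (lead_ideal I d).
Proof.
move=> iI; split.
- by exists 0; [exact: ideal0 iI|rewrite size_poly0 coef0].
- move=> _ _ [p Ip [sp <-]] [q Iq [sq <-]]; exists (p + q); first exact: idealD.
  split; last by rewrite coefD.
  by apply: leq_trans (size_polyD _ _) _; rewrite geq_max sp.
- move=> a _ [p Ip [sp <-]]; exists (a%:P * p); first exact: idealMl.
  split; last by rewrite coefCM.
  by rewrite mul_polyC; apply: leq_trans (size_scale_leq _ _) sp.
Qed.

Lemma lead_idealS (B : comNzRingType) (I : set {poly B}) d e :
  is_ideal I -> (d <= e)%N -> lead_ideal I d `<=` lead_ideal I e.
Proof.
move=> iI /subnK <-; elim: (e - d)%N => [|n IHn] // a /IHn [p Ip [sp pa]].
exists ('X * p); first exact: idealMl.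
split; last by rewrite coefXM.
have [->|p0] := eqVneq p 0; first by rewrite mulr0 size_poly0.
by rewrite mulrC size_mulX.
Qed.

Lemma lead_ideal_mono (B : comNzRingType) (I J : set {poly B}) d :
  I `<=` J -> lead_ideal I d `<=` lead_ideal J d.
Proof. by move=> IJ a [p /IJ Jp ?]; exists p. Qed.

(** Nested ideals of polynomials with the same leading coefficients coincide:
subtracting a member of the smaller ideal kills the leading term. *)
Lemma lead_ideal_inj (B : comNzRingType) (I J : set {poly B}) :
  is_ideal I -> is_ideal J -> I `<=` J ->
  (forall d, lead_ideal J d `<=` lead_ideal I d) -> J `<=` I.
Proof.
move=> iI iJ IJ JI p; move: {2}(size p) (leqnn (size p)) => n.
elim: n p => [|n IHn] p sp Jp.
  by move: sp; rewrite leqn0 size_poly_eq0 => /eqP ->; apply: ideal0 iI.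
have [q Iq [sq qp]] : lead_ideal I n p`_n by apply: JI; exists p.
rewrite -(subrK q p); apply: idealD => //; apply: IHn; last first.
  by apply: idealB => //; apply: IJ.
apply/leq_sizeP => j; rewrite leq_eqVlt => /orP[/eqP <-|nj].
  by rewrite coefB qp subrr.
by rewrite coefB !nth_default ?subrr //; apply: leq_trans nj.
Qed.

(** Hilbert's basis theorem.  The leading-coefficient ideals of all members of
the family have a maximal one, in degree [e] say, which fixes the leading
coefficients in degrees at least [e]; the finitely many smaller degrees are
then maximised one after the other. *)
Lemma noetherian_poly (B : comNzRingType) : noetherian B -> noetherian {poly B}.
Proof.
move=> nB F iF [I0 FI0].
have [||_ [[I1 e] /= FI1 <-] max1] :=
    nB [set lead_ideal Id.1 Id.2 | Id in [set Id | F Id.1]].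
- by move=> _ [[I d] /= FI <-]; apply: is_ideal_lead (iF _ _).
- by exists (lead_ideal I0 0), (I0, 0%N).
have low m : exists I, [/\ F I, I1 `<=` I & forall J, F J -> I `<=` J ->
    forall d, (d < m)%N -> lead_ideal J d `<=` lead_ideal I d].
  elim: m => [|m [I [FI I1I maxI]]]; first by exists I1; split.
  have [||_ [J [FJ IJ] <-] maxJ] :=
      nB [set lead_ideal J m | J in [set J | F J /\ I `<=` J]].
  - by move=> _ [J [FJ _] <-]; apply: is_ideal_lead (iF _ _).
  - by exists (lead_ideal I m), I; split.
  exists J; split=> // [|L FL JL d]; first exact: subset_trans IJ.
  have IL := subset_trans IJ JL.
  rewrite ltnS leq_eqVlt => /orP[/eqP ->|dm].
    by apply: maxJ; [exists L|exact: lead_ideal_mono].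
  by apply: subset_trans (maxI L FL IL d dm) _; apply: lead_ideal_mono.
have [I [FI I1I maxI]] := low e; exists I => // J FJ IJ.
apply: (lead_ideal_inj (iF _ FI) (iF _ FJ) IJ) => d.
have [de|ed] := ltnP d e; first exact: maxI.
have I1e : lead_ideal I1 e `<=` lead_ideal I d.
  by apply: subset_trans (lead_idealS (iF _ FI) ed); apply: lead_ideal_mono.
apply: subset_trans I1e; apply: (max1 (lead_ideal J d)).
  by exists (J, d).
apply: subset_trans (lead_idealS (iF _ FJ) ed).
by apply: lead_ideal_mono; apply: subset_trans IJ.
Qed.

(** Adjoining the generators one at a time makes the algebra a quotient of an
iterated polynomial ring over the field. *)
Lemma noetherian_fg_algebra (k : fieldType) (R : comPzRingType)
  (iota : {rmorphism k -> R}) : fg_algebra iota -> noetherian R.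
Proof.
(* polynomials are evaluated in nontrivial rings, so the zero ring is treated apart *)
move=> [s fg]; have [R0|R0] := eqVneq (1 : R) 0.
  move=> F iF [I FI]; exists I => // J _ _ x _.
  by rewrite -[x]mulr1 R0 mulr0; apply: ideal0 (iF _ FI).
pose R' : comNzRingType :=
  HB.pack_for comNzRingType R (GRing.PzSemiRing_isNonZero.Build R R0).
have [B [f [nB fk fs]]] : exists (B : comNzRingType) (f : {rmorphism B -> R'}),
    [/\ noetherian B, forall c, exists b, f b = iota c
      & forall x, x \in s -> exists b, f b = x].
  elim: s {fg} => [|x s [B [f [nB fk fs]]]].
    by exists k, iota; split=> [||x //]; [exact: noetherian_field|move=> c; exists c].
  have cfx : commr_rmorph f x by move=> b; apply: mulrC.
  exists {poly B}, (horner_morph cfx : {rmorphism {poly B} -> R'}); split.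
  - exact: noetherian_poly.
  - by move=> c; have [b <-] := fk c; exists b%:P; rewrite /= horner_morphC.
  - move=> y; rewrite inE => /orP[/eqP ->|/fs[b <-]].
      by exists 'X; rewrite /= horner_morphX.
    by exists b%:P; rewrite /= horner_morphC.
apply: (@noetherian_surj B R f _ nB) => r.
pose S : {pred R} := fun r => `[< exists b, f b = r >].
apply/asboolP; apply: (fg S) => [|c|x /fs ?]; try exact/asboolP.
split; first by apply/asboolP; exists 1; rewrite rmorph1.
- move=> _ _ /asboolP[a <-] /asboolP[b <-]; apply/asboolP.
  by exists (a - b); rewrite rmorphB.
- move=> _ _ /asboolP[a <-] /asboolP[b <-]; apply/asboolP.
  by exists (a * b); rewrite rmorphM.
Qed.

(** * Primes and idempotents in a Noetherian ring *)

Section NoetherianSpectrum.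
Variable R : comPzRingType.
Hypothesis nR : noetherian R.

(** An ideal maximal among those containing [I] and no power of [s] is prime. *)
Lemma exists_prime (I : set R) (s : R) : is_ideal I -> (forall n, ~ I (s ^+ n)) ->
  exists p : Spec R, I `<=` spec_ideal p /\ ~ spec_ideal p s.
Proof.
move=> iI Is.
have [J [iJ _]|| P [iP IP Ps] Pmax] :=
    nR (F := [set J | [/\ is_ideal J, I `<=` J & forall n, ~ J (s ^+ n)]]).
- by [].
- by exists I; split.
have adjoin x : ~ P x -> exists n b, P (s ^+ n - b * x).
  move=> nPx; apply: contrapT => nex; apply: nPx.
  pose Q := [set y : R | exists b, P (y - b * x)].
  have PQ : P `<=` Q by move=> y Py; exists 0; rewrite mul0r subr0.
  apply: (Pmax Q _ PQ).
    split; [split|exact: subset_trans IP PQ|].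
    + exact/PQ/(ideal0 iP).
    + move=> y z [b Pb] [c Pc]; exists (b + c).
      by rewrite mulrDl opprD addrACA; apply: idealD.
    + move=> a y [b Pb]; exists (a * b).
      by rewrite -mulrA -mulrBr; apply: idealMl.
    + by move=> n [b Pb]; apply: nex; exists n, b.
  by exists 1; rewrite mul1r subrr; apply: ideal0.
have pP : prime_ideal P.
  split; [exact: ideal0|exact: idealD|exact: idealMl|exact: Ps 0|move=> x y Pxy].
  apply: contrapT => /not_orP[/adjoin[m [b Pb]] /adjoin[n [c Pc]]].
  apply: (Ps (m + n)); rewrite exprD.
  have -> : s ^+ m * s ^+ n = s ^+ n * (s ^+ m - b * x) +
      b * x * (s ^+ n - c * y) + b * c * (x * y) by ring.
  by do 2?[apply: (idealD iP)]; apply: (idealMl iP).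
by exists (SpecPoint pP); split=> // /=; rewrite -[s]expr1.
Qed.

Lemma nilpotent_mod (I : set R) (s : R) : is_ideal I ->
  (forall p : Spec R, I `<=` spec_ideal p -> spec_ideal p s) -> exists n, I (s ^+ n).
Proof.
move=> iI Ips; apply: contrapT => /forallNP nI.
by have [p [/Ips]] := exists_prime iI nI.
Qed.

(** An element which is both nilpotent and idempotent modulo [I] vanishes there. *)
Lemma idempotent_mod0 (I : set R) (s : R) : is_ideal I -> I (s * s - s) ->
  (forall p : Spec R, I `<=` spec_ideal p -> spec_ideal p s) -> I s.
Proof.
move=> iI Iss /(nilpotent_mod iI)[n Isn].
have Is n' : I (s ^+ n' * s - s).
  elim: n' => [|m IHm]; first by rewrite mul1r subrr; apply: ideal0.
  have -> : s ^+ m.+1 * s - s = s * (s ^+ m * s - s) + (s * s - s).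
    by rewrite exprS; ring.
  by apply: idealD => //; apply: idealMl.
rewrite -[s](subKr (s ^+ n * s)); apply: idealB => //.
by rewrite mulrC; apply: idealMl.
Qed.

(** The product [a * (1 - b)] is idempotent modulo [I] and lies in every prime over
[I].  Hence an idempotent modulo [I] is determined by the primes containing it. *)
Lemma idempotent_mod_le (I : set R) (a b : R) : is_ideal I ->
  I (a * a - a) -> I (b * b - b) ->
  (forall p : Spec R, I `<=` spec_ideal p -> ~ spec_ideal p a -> ~ spec_ideal p b) ->
  I (a * (1 - b)).
Proof.
move=> iI Iaa Ibb ab; apply: idempotent_mod0 => //.
  have -> : a * (1 - b) * (a * (1 - b)) - a * (1 - b)
      = (1 - b) * (1 - b) * (a * a - a) + a * (b * b - b) by ring.
  by apply: idealD => //; apply: idealMl.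
move=> p Ip; have ip := is_ideal_prime p; have pp := spec_prime p.
have [pa|/(ab p Ip) npb] := pselect (spec_ideal p a).
  by rewrite mulrC; apply: idealMl.
apply: idealMl => //; have /(prime_idealP pp) [//|] : spec_ideal p (b * (1 - b)).
  have -> : b * (1 - b) = - 1 * (b * b - b) by ring.
  exact/(idealMl ip)/Ip.
by [].
Qed.

Lemma closed_zeros (C : set (Spec R)) : closed C <-> exists S, C = zeros S.
Proof.
rewrite -openC; split=> [[S CS]|[S ->]]; last by exists S.
by exists S; rewrite -[C]setCK CS setCK.
Qed.

Definition vanishing (C : set (Spec R)) : set R :=
  [set r | forall p, C p -> spec_ideal p r].

Lemma is_ideal_vanishing C : is_ideal (vanishing C).
Proof.
split=> [p Cp|x y Cx Cy p Cp|a x Cx p Cp].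
- exact: ideal0 (is_ideal_prime p).
- by apply: (idealD (is_ideal_prime p)); [apply: Cx|apply: Cy].
- by apply: (idealMl (is_ideal_prime p)); apply: Cx.
Qed.

Lemma vanishing_closed (C : set (Spec R)) (p : Spec R) :
  closed C -> vanishing C `<=` spec_ideal p -> C p.
Proof.
move=> /closed_zeros[S ->] Cp s Ss; apply: Cp => q; exact.
Qed.

(** Disjoint closed sets are separated by coprime elements [x] and [y]; their
product is nilpotent modulo [I], so after raising both to a power they become
orthogonal, and the terms of a Bezout relation are the two idempotents. *)
Lemma exists_idempotent (I : set R) (C D : set (Spec R)) : is_ideal I ->
  closed C -> closed D -> C `&` D = set0 -> zeros I `<=` C `|` D ->
  exists e, I (e * e - e) /\
    forall p : Spec R, I `<=` spec_ideal p -> (C p <-> ~ spec_ideal p e).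
Proof.
move=> iI cC cD CD0 ICD.
pose comax (a b : set R) := [set z | exists x y, [/\ a x, b y & z = x + y]].
have comaxE (a b : set R) : is_ideal a -> is_ideal b ->
    (forall p : Spec R, a `<=` spec_ideal p -> b `<=` spec_ideal p -> False) ->
    exists x y, [/\ a x, b y & 1 = x + y].
  move=> ia ib ab; have iab : is_ideal (comax a b).
    split.
    - by exists 0, 0; split; [exact: ideal0|exact: ideal0|rewrite addr0].
    - move=> _ _ [x [y [ax bY ->]]] [x' [y' [ax' bY' ->]]].
      exists (x + x'), (y + y'); split; try exact: idealD.
      by rewrite addrACA.
    - move=> c _ [x [y [ax bY ->]]].
      by exists (c * x), (c * y); split; rewrite ?mulrDr //; apply: idealMl.
  have [p abp|n] := @nilpotent_mod (comax a b) 1 iab.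
    exfalso; apply: (ab p) => x xp; apply: abp.
      by exists x, 0; split; [|exact: ideal0|rewrite addr0].
    by exists 0, x; split; [exact: ideal0| |rewrite add0r].
  by rewrite expr1n.
have iC := is_ideal_vanishing C; have iD := is_ideal_vanishing D.
have [x [y [Cx Dy xy]]] : exists x y, [/\ vanishing C x, vanishing D y & 1 = x + y].
  apply: comaxE => // p Cp Dp; have : (C `&` D) p by split; exact: vanishing_closed.
  by rewrite CD0.
have [n In] : exists n, I ((x * y) ^+ n).
  apply: nilpotent_mod => // p /ICD[/Cx|/Dy] h; last exact: idealMl (is_ideal_prime p) _ _ h.
  by rewrite mulrC; apply: idealMl (is_ideal_prime p) _ _ h.
have iP z : is_ideal [set r | exists c : R, r = c * z].
  split=> [|_ _ [c ->] [d ->]|a _ [c ->]]; first by exists 0; rewrite mul0r.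
    by exists (c + d); rewrite mulrDl.
  by exists (a * c); rewrite mulrA.
have root (p : Spec R) z : spec_ideal p (z ^+ n.+1) -> spec_ideal p z.
  elim: (n.+1) => [|m IHm]; first by move=> /(ideal1 (is_ideal_prime p)).
  by rewrite exprS => /(prime_idealP (spec_prime p))[//|/IHm].
have [_ [_ [[c ->] [d ->] cd]]] : exists x' y', [/\ exists c, x' = c * x ^+ n.+1,
    exists d, y' = d * y ^+ n.+1 & 1 = x' + y'].
  apply: comaxE => [||p px py]; [exact: iP|exact: iP|].
  apply: (prime_ideal1 (spec_prime p)); rewrite xy.
  apply: (idealD (is_ideal_prime p)); apply: root; [apply: px|apply: py];
    by exists 1; rewrite mul1r.
exists (d * y ^+ n.+1); split.
  have -> : d * y ^+ n.+1 * (d * y ^+ n.+1) - d * y ^+ n.+1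
      = - (d * c * x * y) * (x * y) ^+ n.
    have -> : d * y ^+ n.+1 * (d * y ^+ n.+1) - d * y ^+ n.+1
      = - (d * y ^+ n.+1 * (1 - d * y ^+ n.+1)) by ring.
    by rewrite cd addrK exprMn !exprS; ring.
  exact: idealMl.
move=> p Ip; have ip := is_ideal_prime p; split=> [Cp pd|npd].
  apply: (prime_ideal1 (spec_prime p)); rewrite cd; apply: (idealD ip) => //.
  by rewrite exprSr mulrA; apply: (idealMl ip); apply: Cx.
have [//|Dp] := ICD p Ip; case: npd.
by rewrite exprSr mulrA; apply: (idealMl ip); apply: Dy.
Qed.

(** * Connected components of closed sets *)

(** Among the closed sets containing [p] whose complement in [Z] is closed, a
minimal one is connected, because a splitting of it would be a smaller such
set; hence it is the component of [p]. *)
Lemma component_clopen (Z : set (Spec R)) (p : Spec R) : closed Z -> Z p ->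
  closed (connected_component Z p) /\
  exists D, [/\ closed D, connected_component Z p `&` D = set0
              & connected_component Z p `|` D = Z].
Proof.
move=> cZ Zp.
pose part C D := [/\ closed C, closed D, C `&` D = set0, C `|` D = Z & C p].
have [|| _ [C [D [cC cD CD0 CDZ Cp]] <-] Cmax] :=
    nR (F := [set vanishing C | C in [set C | exists D, part C D]]).
- by move=> _ [C _ <-]; exact: is_ideal_vanishing.
- exists (vanishing Z), Z => //; exists set0.
  by split; rewrite ?setI0 ?setU0 //; exact: closed0.
have Cmin C' D' : part C' D' -> C' `<=` C -> C `<=` C'.
  move=> pC'; have [cC' _ _ _ _] := pC' => C'C q Cq; apply: vanishing_closed => //.
  move=> r /Cmax; apply=> //; first by exists C' => //; exists D'.
  by move=> s Cs q' /C'C; apply: Cs.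
have Cconn : connected C.
  move=> B [q Bq] [O oO BO] [K cK BK].
  have cB : closed B by rewrite BK; exact: closedI.
  have cB' : closed (C `\` B).
    rewrite BO setDIr setDv set0U setDE; apply: closedI => //.
    exact: open_closedC.
  have BC : B `<=` C by rewrite BO => ? [].
  have CB : C = B `|` (C `\` B) by rewrite setDUK.
  have [Bp|nBp] := pselect (B p).
    apply/seteqP; split=> //; apply: (Cmin B (C `\` B `|` D)) => //; split=> //.
    - exact: closedU.
    - by rewrite setIUr setDIK set0U -subset0 -CD0; apply: setSI.
    - by rewrite setUA -CB.
  suff CB' : C `<=` C `\` B by have /CB'[] := BC q Bq.
  apply: (Cmin _ (B `|` D)) => [|? []//]; split=> //.
  - exact: closedU.
  - by rewrite setIUr setDKI set0U -subset0 -CD0; apply: setSI => ? [].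
  - by rewrite setUA [_ `|` B]setUC -CB.
have CZ : C `<=` Z by rewrite -CDZ; exact: subsetUl.
suff -> : connected_component Z p = C by split=> //; exists D.
set W := connected_component Z p; apply/seteqP; split; last exact: connected_component_max.
have WZ : W `<=` C `|` D by rewrite CDZ; exact: connected_component_sub.
have WC : W `&` C = W.
  apply: (component_connected (A := Z) (x := p)).
  - by exists p; split=> //; exact: connected_component_refl.
  - exists (~` D); first exact: closed_openC.
    apply/seteqP; split=> q [Wq h]; split=> //.
      by move=> Dq; have : (C `&` D) q by []; rewrite CD0.
    by have [|/h] := WZ q Wq.
  - by exists C.
by rewrite -WC => q [].
Qed.

End NoetherianSpectrum.

(** * The translates of the zero locus of v *)

Lemma Spec_ext (R : comPzRingType) (p q : Spec R) :
  (forall r, spec_ideal p r <-> spec_ideal q r) -> p = q.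
Proof.
case: p q => [p pP] [q qP] /= pq.
have {}pq : p = q by apply/funext => r; apply/propext.
by subst q; congr SpecPoint; exact: Prop_irrelevance.
Qed.

Lemma continuous_spec_preimage (R : comPzRingType) (f : {rmorphism R -> R}) :
  continuous (spec_preimage f).
Proof.
apply/continuousP => _ [S ->]; exists (f @` S); rewrite preimage_setC.
congr (~` _); apply/seteqP; split=> p /=; last by move=> h r Sr; apply: h; exists r.
by move=> h _ [r Sr <-]; apply: h.
Qed.

Section Translates.
Variables (R : comPzRingType) (sigma : ringAut R) (v : R).
Local Notation tau := (autV sigma).
Local Notation Z := (Zset v).
Local Notation Xi n := (Xi_pow sigma n).

Lemma iter_autK n : cancel (iter n sigma) (iter n tau).
Proof. by elim: n => [|n IHn] // r; rewrite iterS iterSr IHn autK. Qed.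
Lemma iter_autVK n : cancel (iter n tau) (iter n sigma).
Proof. by elim: n => [|n IHn] // r; rewrite iterS iterSr IHn autVK. Qed.

Lemma iter_spec_preimage (f : {rmorphism R -> R}) n p r :
  spec_ideal (iter n (spec_preimage f) p) r <-> spec_ideal p (iter n f r).
Proof. by elim: n r => [|n IHn] r //=; rewrite IHn -iterSr. Qed.

Lemma Xi_powN n p : Xi (- n%:Z) p = iter n (spec_preimage tau) p.
Proof. by case: n. Qed.

Lemma Xi_powK n p : Xi (- n%:Z) (Xi n%:Z p) = p.
Proof.
rewrite Xi_powN; apply: Spec_ext => r.
by rewrite !iter_spec_preimage iter_autVK.
Qed.
Lemma Xi_powNK n p : Xi n%:Z (Xi (- n%:Z) p) = p.
Proof.
rewrite Xi_powN; apply: Spec_ext => r.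
by rewrite !iter_spec_preimage iter_autK.
Qed.

Lemma Xi_pow_ZsetP n p : (Xi n%:Z @` Z) p <-> spec_ideal p (iter n tau v).
Proof.
split=> [[q qv <-]|pv]; first by rewrite iter_spec_preimage iter_autVK.
exists (Xi (- n%:Z) p); last exact: Xi_powNK.
by rewrite /Zset /= Xi_powN iter_spec_preimage.
Qed.

Lemma Xi_powN_ZsetP n p : (Xi (- n%:Z) @` Z) p <-> Z (Xi n%:Z p).
Proof.
split=> [[q Zq <-]|Zp]; first by rewrite Xi_powNK.
by exists (Xi n%:Z p); rewrite // Xi_powK.
Qed.

Lemma closed_Xi_pow_Zset n : closed (Xi n%:Z @` Z).
Proof.
apply/closed_zeros; exists [set iter n tau v]; apply/seteqP.
split=> p; first by move=> /Xi_pow_ZsetP pv _ ->.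
by move=> pv; apply/Xi_pow_ZsetP/pv.
Qed.

Lemma continuous_Xi_powN n : continuous (Xi (- n%:Z)).
Proof.
have -> : Xi (- n%:Z) = iter n (spec_preimage tau) by apply/funext/Xi_powN.
elim: n => [|n IHn] p; first exact: cvg_id.
apply: (@continuous_comp _ _ _ (iter n (spec_preimage tau)) (spec_preimage tau)).
  exact: IHn.
exact: continuous_spec_preimage.
Qed.

Definition avoids W N :=
  forall n, (N <= n)%N -> W `&` (Xi n%:Z @` Z) = set0.

Lemma pi0P W p : pi0 Z W -> W p -> Z p /\ W = connected_component Z p.
Proof.
move=> [q Zq <-] qp; split; first exact: connected_component_sub qp.
exact: same_connected_component.
Qed.

Lemma pi0_component p : Z p -> pi0 Z (connected_component Z p).
Proof. by exists p. Qed.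

Hypothesis star : condition_star sigma v.

Lemma star_sub W (n : int) p : pi0 Z W -> W p -> (Xi n @` Z) p -> W `<=` Xi n @` Z.
Proof.
move=> pW Wp Xp; have [/(_ n) [W0|pWX] _] := star pW.
  by have : (W `&` (Xi n @` Z)) p by []; rewrite W0.
have [_ WE] := pi0P pW Wp; have [_ WXE] : _ /\ _ := pi0P pWX (conj Wp Xp).
by rewrite {1}WE -WXE => q [].
Qed.

(** Where a component [W] of [Z] meets a translate of [Z], it is a full component
of that translate: moving the latter back, the condition for the opposite
exponent shows that it lies in [Z]. *)
Lemma component_translate W n p : pi0 Z W -> W p -> (Xi n%:Z @` Z) p ->
  connected_component (Xi n%:Z @` Z) p = W.
Proof.
move=> pW Wp Xp; set C := connected_component _ p.
have [Zp WE] := pi0P pW Wp.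
have Wc : connected W by rewrite WE; exact: component_connected.
apply/seteqP; split; last first.
  by apply: connected_component_max => //; exact: star_sub Xp.
rewrite WE; apply: connected_component_max.
- exact: connected_component_refl.
- set q := Xi (- n%:Z) p.
  have Zq : Z q by have [q' Zq' q'p] := Xp; rewrite /q -q'p Xi_powK.
  have XW : connected_component Z q `<=` Xi (- n%:Z) @` Z.
    apply: (star_sub (p := q)); first exact: pi0_component.
      exact: connected_component_refl.
    by exists p.
  have CW : Xi (- n%:Z) @` C `<=` connected_component Z q.
    apply: connected_component_max.
    + by exists p => //; exact: connected_component_refl.
    + move=> _ [r /connected_component_sub [r' Zr' <-] <-].
      by rewrite Xi_powK.
    + apply: connected_continuous_connected; first exact: component_connected.
      exact/continuous_subspaceT/continuous_Xi_powN.
  move=> r Cr; have /Xi_powN_ZsetP : (Xi (- n%:Z) @` Z) (Xi (- n%:Z) r).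
    by apply/XW/CW; exists r.
  by rewrite Xi_powNK.
- exact: component_connected.
Qed.

Hypothesis nR : noetherian R.

Lemma closed_pi0 W : pi0 Z W -> closed W.
Proof.
move=> [p Zp <-]; have cZ : closed Z.
  by have := @closed_Xi_pow_Zset 0%N; rewrite image_id.
by have [] := component_clopen nR cZ Zp.
Qed.

(** In the algebra this element is [tplus ^+ n * tminus ^+ n]. *)
Definition vprod n : R := \prod_(j < n) iter j tau v.

Lemma spec_prod (p : Spec R) n (F : nat -> R) :
  spec_ideal p (\prod_(j < n) F j) -> exists2 j : nat, (j < n)%N & spec_ideal p (F j).
Proof.
elim: n => [|n IHn]; first by rewrite big_ord0 => /(prime_ideal1 (spec_prime p)).
rewrite big_ord_recr => /(prime_idealP (spec_prime p))[/IHn[j jn pj]|pn].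
  by exists j => //; exact: ltnW.
by exists n.
Qed.

(** In each translate of [Z] the set [W] is a component or absent, so its complement
there is closed; [D] is the finite union of these complements. *)
Lemma translates_separated W n : pi0 Z W ->
  exists D, [/\ closed D, W `&` D = set0
              & forall p, spec_ideal p (vprod n) -> W p \/ D p].
Proof.
move=> pW.
have sep j : exists D, [/\ closed D, W `&` D = set0 & Xi j%:Z @` Z `<=` W `|` D].
  have cX := @closed_Xi_pow_Zset j.
  have [[p [Wp Xp]]|W0] := pselect (exists p, W p /\ (Xi j%:Z @` Z) p).
    have [_ [D]] := component_clopen nR cX Xp.
    rewrite (component_translate pW Wp Xp) => -[cD WD0 <-].
    by exists D; split.
  exists (Xi j%:Z @` Z); split=> //.
  by rewrite -subset0 => p [Wp Xp]; apply: W0; exists p.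
have {sep} [D [cD D0 DZ]] : exists D, [/\ closed D, W `&` D = set0
    & forall j, (j < n)%N -> Xi j%:Z @` Z `<=` W `|` D].
  elim: n => [|n [D [cD D0 DZ]]].
    by exists set0; split=> //; [exact: closed0|rewrite setI0].
  have [E [cE E0 EZ]] := sep n.
  exists (D `|` E); split; first exact: closedU.
    by rewrite setIUr D0 E0 setU0.
  move=> j; rewrite ltnS leq_eqVlt => /orP[/eqP ->|/DZ jZ] p.
    by move/EZ => [?|?]; [left|right; right].
  by move/jZ => [?|?]; [left|right; left].
exists D; split=> // p /spec_prod [j jn pj].
by have /DZ := jn; apply; apply/Xi_pow_ZsetP.
Qed.

Lemma exists_component_idempotent W n : pi0 Z W ->
  exists e, (exists r, e * e - e = r * vprod n) /\
    forall p : Spec R, spec_ideal p (vprod n) -> (W p <-> ~ spec_ideal p e).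
Proof.
move=> pW; have [D [cD D0 DW]] := translates_separated n pW.
have iI : is_ideal [set x | exists r, x = r * vprod n].
  split=> [|_ _ [c ->] [d ->]|a _ [c ->]]; first by exists 0; rewrite mul0r.
    by exists (c + d); rewrite mulrDl.
  by exists (a * c); rewrite mulrA.
have [p Ip|e [Iee We]] := exists_idempotent nR iI (closed_pi0 pW) cD D0.
  by apply: DW; apply: Ip; exists 1; rewrite mul1r.
exists e; split=> // p pv; apply: We => _ [r ->].
exact: idealMl (is_ideal_prime p) _ _ pv.
Qed.

End Translates.

(** * Annihilators and vectors of weight W *)

Section WeightVectors.
Variables (R : comPzRingType) (sigma : ringAut R) (v : R).
Local Notation A := (gwa sigma v).
Local Notation coef := (@gwa_coef R sigma v).
Local Notation tp := (@tplus R sigma v).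
Local Notation tm := (@tminus R sigma v).
Local Notation tau := (autV sigma).
Local Notation Z := (Zset v).
Local Notation Amod n := (Amod sigma v n).
Local Notation vp n := (vprod sigma v n).

Definition Amod_pi n : A -> Amod n := coker_pi (mul_tminus n : {linear A^o -> A^o}).

Lemma Amod_piP n (a b : A) : Amod_pi n a = Amod_pi n b <-> exists c, a - b = c * tm ^+ n.
Proof. exact: coker_piP. Qed.

Lemma Amod_piM n (a b : A) : Amod_pi n (a * b) = a *: Amod_pi n b.
Proof. by rewrite /Amod_pi -linearZ. Qed.

Lemma Amod_pi_surj n (q : Amod n) : exists a, q = Amod_pi n a.
Proof. by exists (coker_repr q); rewrite [RHS]coker_reprK. Qed.

Lemma ract_Amod_pi n r (a : A) : ract r (Amod_pi n a) = Amod_pi n (a * coef r).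
Proof.
rewrite -[a in LHS]mulr1 Amod_piM ract_scale Amod_piM; congr (_ *: _).
have h1 i : hcomp i (Amod_pi n 1) = if i == 0 then Amod_pi n 1 else 0.
  rewrite [LHS]coker_hcomp_pi; last exact: mul_tminus_graded.
  rewrite [hcomp _ _](@homog_gwa_hcomp _ _ _ i 0); first by case: ifP; rewrite ?raddf0.
  by rewrite -(rmorph1 coef); exact: homog_coef.
apply: hcomp_ext => i; rewrite -[coef r]mulr1 Amod_piM ractE -[X in _ = hcomp X _]add0r.
rewrite hcompZ; last exact: homog_coef.
by rewrite h1; case: eqP => [->|_]; rewrite ?scaler0.
Qed.

Lemma ann_AmodP n r : ann (Amod n) r <-> exists b, coef r = b * tm ^+ n.
Proof.
have E0 a : Amod_pi n a = 0 <-> exists b, a = b * tm ^+ n.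
  have <- : Amod_pi n 0 = 0 by exact: raddf0.
  by rewrite Amod_piP subr0.
split=> [/(_ (Amod_pi n 1))|[b rb] q]; first by rewrite ract_Amod_pi mul1r => /E0.
have [a ->] := Amod_pi_surj q; rewrite ract_Amod_pi; apply/E0.
by exists (a * b); rewrite rb mulrA.
Qed.

Lemma is_ideal_ann_Amod n : is_ideal (ann (Amod n)).
Proof.
split=> [|x y /ann_AmodP[b xb] /ann_AmodP[c yc]|a x /ann_AmodP[b xb]]; apply/ann_AmodP.
- by exists 0; rewrite rmorph0 mul0r.
- by exists (b + c); rewrite rmorphD /= xb yc mulrDl.
- by exists (coef a * b); rewrite rmorphM /= xb mulrA.
Qed.

Lemma ann_AmodS m n : (m <= n)%N -> ann (Amod n) `<=` ann (Amod m).
Proof.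
move=> mn r /ann_AmodP[b rb]; apply/ann_AmodP; exists (b * tm ^+ (n - m)).
by rewrite -mulrA -exprD subnK.
Qed.

(** A vector killed by [tminus ^+ n] is the image of the generator of [Amod n]. *)
Lemma ann_Amod_kill n r (M : lmodType A) (x : M) :
  tm ^+ n *: x = 0 -> ann (Amod n) r -> coef r *: x = 0.
Proof. by move=> x0 /ann_AmodP[b ->]; rewrite -scalerA x0 scaler0. Qed.

Lemma tminusX_coefE k r : tm ^+ k * coef r = coef (iter k sigma r) * tm ^+ k.
Proof.
elim: k r => [|k IHk] r; first by rewrite mul1r mulr1.
by rewrite exprSr -mulrA -coef_tminus mulrA IHk mulrA -iterSr.
Qed.

Lemma tplusX_coef k r : tp ^+ k * coef r = coef (iter k tau r) * tp ^+ k.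
Proof.
elim: k r => [|k IHk] r; first by rewrite mul1r mulr1.
by rewrite exprSr -mulrA -{1}(autVK sigma r) -coef_tplus mulrA IHk mulrA -iterSr.
Qed.

Lemma tplusX_tminusX k : tp ^+ k * tm ^+ k = coef (vp k).
Proof.
elim: k => [|k IHk]; first by rewrite mulr1 /vprod big_ord0 rmorph1.
rewrite exprSr exprS -mulrA [tp * _]mulrA tplus_tminus mulrA tplusX_coef.
by rewrite -mulrA IHk -rmorphM /vprod big_ord_recr mulrC.
Qed.

Lemma ann_vprod n : ann (Amod n) (vp n).
Proof. by apply/ann_AmodP; exists (tp ^+ n); rewrite tplusX_tminusX. Qed.

Hypothesis star : condition_star sigma v.
Hypothesis nR : noetherian R.

Lemma idempotent_liftP W n : pi0 Z W ->
  lifts_idempotent (Amod n) W (idempotent_lift (Amod n) W).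
Proof.
move=> pW; rewrite /idempotent_lift.
case: xgetP => [e -> //|none].
have [e [[r er] We]] := exists_component_idempotent star nR n pW.
case: (none e); split=> [|p /(_ _ (@ann_vprod n))]; last exact: We.
by rewrite er; apply/(idealMl (is_ideal_ann_Amod n))/ann_vprod.
Qed.

Variables (W : set (Spec R)) (N : nat).
Hypothesis pW : pi0 Z W.
Hypothesis N_large : avoids sigma v W N.

Local Notation e n := (idempotent_lift (Amod n) W).

Lemma idempotent_lift_idem n : ann (Amod n) (e n * e n - e n).
Proof. by have [] := idempotent_liftP n pW. Qed.

Lemma idempotent_lift_supp n p :
  ann (Amod n) `<=` spec_ideal p -> (W p <-> ~ spec_ideal p (e n)).
Proof. by have [_] := idempotent_liftP n pW; apply. Qed.

(** The vectors which can be the image of the generator [1_W] of [PW W N]. *)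
Definition weight_vector (M : lmodType A) (x : M) : Prop :=
  tm ^+ N *: x = 0 /\ coef (e N) *: x = x.

(** For [k >= N] the summands of [Amod k] and [Amod N] at [W] agree.  The kernel
of [Amod k -> Amod N] is generated by the class of [tminus ^+ N], and the
right annihilator [J] of that class contains a product of translates of [v] by
exponents at least [N], whose zeros avoid [W]; so the idempotent [e k] is
nilpotent modulo [J], hence lies in [J]. *)
Lemma tminusX_idempotent_lift k :
  (N <= k)%N -> exists b, tm ^+ N * coef (e k) = b * tm ^+ k.
Proof.
move=> Nk; pose J := [set r | exists b, tm ^+ N * coef r = b * tm ^+ k].
have iJ : is_ideal J.
  split=> [|x y [b xb] [c yc]|a x [b xb]]; first by exists 0; rewrite rmorph0 mulr0 mul0r.
    by exists (b + c); rewrite rmorphD mulrDr mulrDl xb yc.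
  exists (coef (iter N sigma a) * b).
  by rewrite rmorphM mulrA tminusX_coefE -!mulrA xb.
have annJ : ann (Amod k) `<=` J.
  by move=> r /ann_AmodP[b rb]; exists (tm ^+ N * b); rewrite rb mulrA.
have Ju : J (iter N tau (vp (k - N))).
  exists (tp ^+ (k - N)); rewrite tminusX_coefE iter_autVK -tplusX_tminusX.
  by rewrite -mulrA -exprD subnK.
apply: (idempotent_mod0 nR iJ); first exact/annJ/idempotent_lift_idem.
move=> p Jp; apply: contrapT => /(idempotent_lift_supp (subset_trans annJ Jp)) Wp.
have iterM n x y : iter n tau (x * y) = iter n tau x * iter n tau y.
  by elim: n => //= n ->; rewrite rmorphM.
have iter1 n : iter n tau 1 = 1 by elim: n => //= n ->; rewrite rmorph1.
move/Jp: Ju; rewrite /vprod (big_morph _ (iterM N) (iter1 N)).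
under eq_bigr do rewrite -iterD.
move=> /(spec_prod (F := fun j => iter (N + j) tau v)) [j _ /Xi_pow_ZsetP pX].
have : (W `&` (Xi_pow sigma (N + j)%:Z @` Z)) p by [].
by rewrite N_large ?leq_addr.
Qed.

Lemma idempotent_lift_compare k : (N <= k)%N ->
  ann (Amod N) (e N * (1 - e k)) /\ ann (Amod N) (e k * (1 - e N)).
Proof.
move=> Nk; have iN := is_ideal_ann_Amod N.
have kN := @ann_AmodS N k Nk.
have eN := @idempotent_lift_idem N; have ek := kN _ (@idempotent_lift_idem k).
by split; apply: idempotent_mod_le => // p Ip; have WN := idempotent_lift_supp Ip;
   have Wk := idempotent_lift_supp (subset_trans kN Ip); tauto.
Qed.

Lemma weight_vector_fixed k (M : lmodType A) (x : M) :
  (N <= k)%N -> weight_vector x -> coef (e k) *: x = x.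
Proof.
move=> Nk [x0 ex]; have [/(ann_Amod_kill x0) + _] := idempotent_lift_compare Nk.
rewrite mulrC rmorphM rmorphB rmorph1 -scalerA ex scalerBl scale1r.
by move=> /eqP; rewrite subr_eq0 => /eqP <-.
Qed.

Lemma weight_vector_proj k (M : lmodType A) (x : M) :
  (N <= k)%N -> tm ^+ k *: x = 0 -> weight_vector (coef (e k) *: x).
Proof.
move=> Nk x0; have [b bE] := tminusX_idempotent_lift Nk.
have ex0 : tm ^+ N *: (coef (e k) *: x) = 0.
  by rewrite scalerA bE -scalerA x0 scaler0.
split=> //; have [_ /(ann_Amod_kill ex0)] := idempotent_lift_compare Nk.
have ekk : coef (e k) *: (coef (e k) *: x) = coef (e k) *: x.
  have /eqP := ann_Amod_kill x0 (@idempotent_lift_idem k).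
  by rewrite rmorphB rmorphM scalerBl -scalerA subr_eq0 => /eqP.
rewrite mulrC rmorphM -scalerA ekk rmorphB rmorph1 scalerBl scale1r.
by move=> /eqP; rewrite subr_eq0 => /eqP <-.
Qed.

(** * The universal property of the summand *)

Local Notation P := (PW sigma v W N).

Fact PW_gen_subproof : Amod_pi N (coef (e N)) \in
  im_pred (act_idempotent (M := Amod N) W : {linear Amod N -> Amod N}).
Proof.
apply/im_predP; exists (Amod_pi N 1).
by rewrite [RHS]ract_Amod_pi mul1r.
Qed.

Definition PW_gen : P := ImMod PW_gen_subproof.

Lemma val_PWZ (a : A) (y : P) : val (a *: y) = a *: (val y : Amod N).
Proof. exact: linearZ. Qed.

Lemma PW_gen_span (y : P) : exists a : A, y = a *: PW_gen.
Proof.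
have /im_predP[q yq] := valP y; have [a qa] := Amod_pi_surj q.
exists a; apply: val_inj; rewrite [LHS]yq qa [LHS]ract_Amod_pi Amod_piM.
by rewrite [RHS]val_PWZ.
Qed.

Lemma PW_gen_weight : weight_vector PW_gen.
Proof.
split; apply: val_inj; rewrite [LHS]val_PWZ /= -Amod_piM.
  rewrite tminusX_coefE; have -> : 0 = Amod_pi N 0 by exact/esym/raddf0.
  by apply/Amod_piP; exists (coef (iter N sigma (e N))); rewrite subr0.
have /ann_AmodP[b bE] := @idempotent_lift_idem N.
by apply/Amod_piP; exists b; rewrite -rmorphM -rmorphB.
Qed.

Lemma PW_gen_homogeneous : homogeneous 0 PW_gen.
Proof.
apply: val_inj => /=; rewrite [LHS]coker_hcomp_pi; last exact: mul_tminus_graded.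
by congr coker_pi; rewrite [LHS](homog_gwa_hcomp _ (homog_coef _ _ _)) eqxx.
Qed.

Lemma weight_vector_linear (M M' : lmodType A) (f : {linear M -> M'}) x :
  weight_vector x -> weight_vector (f x).
Proof. by move=> [x0 ex]; split; rewrite -linearZ ?x0 ?ex ?raddf0. Qed.

Section MapOut.
Variables (M : lmodType A) (m : M) (m_weight : weight_vector m).

(** Two representatives differ by a multiple of [tminus ^+ N], which kills [m], so the
choice made by [coker_repr] is harmless. *)
Definition PW_map (y : P) : M := (coker_repr (val y : Amod N) : A) *: m.

Lemma PW_mapE (a : A) : PW_map (a *: PW_gen) = a *: m.
Proof.
rewrite /PW_map val_PWZ /= -Amod_piM; set q := Amod_pi N _.
have /Amod_piP[c cE] : Amod_pi N (coker_repr q) = q by exact: coker_reprK.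
rewrite -(subrK (a * coef (e N)) (coker_repr q : A)) cE scalerDl -!scalerA.
by have [-> ->] := m_weight; rewrite scaler0 add0r.
Qed.

Fact PW_map_zmod_morphism : zmod_morphism PW_map.
Proof.
move=> x y; have [a ->] := PW_gen_span x; have [b ->] := PW_gen_span y.
by rewrite -scalerBl !PW_mapE scalerBl.
Qed.
HB.instance Definition _ := GRing.isZmodMorphism.Build P M PW_map PW_map_zmod_morphism.
Fact PW_map_scalable : scalable PW_map.
Proof. by move=> a x; have [b ->] := PW_gen_span x; rewrite scalerA !PW_mapE scalerA. Qed.
HB.instance Definition _ := GRing.isScalable.Build A P M *:%R PW_map PW_map_scalable.

Lemma exists_PW_map : exists h : {linear P -> M}, h PW_gen = m.
Proof. by exists (PW_map : {linear P -> M}); rewrite -[PW_gen]scale1r /= PW_mapE scale1r. Qed.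

End MapOut.
End WeightVectors.

(** * Surjectivity of epimorphisms and homogeneous components *)

Section GradedMaps.
Variables (R : comPzRingType) (sigma : ringAut R) (v : R).
Local Notation A := (gwa sigma v).
Local Notation tm := (@tminus R sigma v).

Lemma hcomp_scale_homogeneous (M : gradedModule sigma v) (x : M) (i d : int) (a : A) :
  homogeneous d x -> hcomp (i + d) (a *: x) = gwa_hcomp i a *: x.
Proof.
move=> hx; have [s Hs ->] := gwa_decomp a.
rewrite [gwa_hcomp i _](hcomp_bigsum (M := gwa_regular sigma v)) !scaler_suml.
rewrite hcomp_bigsum; apply: eq_big_seq => p /Hs Hp.
rewrite [hcomp (g := gwa_regular sigma v) _ _](homog_gwa_hcomp _ Hp) -{1}hx -(hcompZ _ _ Hp) hcompK.
rewrite (inj_eq (addIr d)) (hcompZ _ _ Hp) hx.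
by case: eqP; rewrite ?scale0r.
Qed.

Lemma grHom_hcomp (M M' : gradedModule sigma v) (f : grHom M M') i x :
  hcomp i (f x) = f (hcomp i x).
Proof.
have [s [us s0 xE]] := hcomp_seq x.
have fj j : hcomp i (f (hcomp j x)) = if i == j then f (hcomp j x) else 0.
  have <- : hcomp j (f (hcomp j x)) = f (hcomp j x).
    by apply: gr_homogeneous; rewrite /homogeneous hcompK eqxx.
  by rewrite hcompK.
rewrite {1}xE raddf_sum hcomp_bigsum (eq_bigr _ (fun j _ => fj j)).
have [si|si] := boolP (i \in s).
  rewrite (bigD1_seq i) //= eqxx big1 ?addr0 // => j.
  by rewrite eq_sym => /negPf ->.
rewrite s0 // raddf0 big_seq big1 // => j sj; case: eqP => // ij.
by rewrite ij sj in si.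
Qed.

Lemma coker_nilpotent (M M' : lmodType A) (f : {linear M -> M'}) :
  locally_nilpotent M' -> locally_nilpotent (coker_mod f : lmodType A).
Proof.
move=> nil q; rewrite -[q]coker_reprK; have [k kP] := nil (coker_repr q).
by exists k => n /kP nq; rewrite -linearZ nq raddf0.
Qed.

Lemma coker_pi_eq0 (M M' : lmodType A) (f : {linear M -> M'}) y :
  coker_pi f y = 0 -> exists x, f x = y.
Proof.
have <- : coker_pi f 0 = 0 by exact: raddf0.
by move=> /coker_piP[x]; rewrite subr0; exists x.
Qed.

Lemma epi_surj_Ocat (X Y : Ob (Ocat sigma v)) (f : Defs.Hom X Y) :
  epi f -> forall y : O_module Y, exists x, (f : {linear _ -> _}) x = y.
Proof.
move=> epif y; apply: coker_pi_eq0.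
pose C := OObject (coker_nilpotent (f := f) (@O_nilpotent _ _ _ Y)).
pose q : Defs.Hom (c := Ocat sigma v) Y C := coker_pi f : {linear _ -> _}.
pose z : Defs.Hom (c := Ocat sigma v) Y C := \0 : {linear _ -> _}.
suff qz : q = z by rewrite -[LHS]/((q : {linear _ -> _}) y) qz.
apply: epif; apply: linear_ext => x /=.
have <- : coker_pi f 0 = 0 by exact: raddf0.
by apply/coker_piP; exists x; rewrite subr0.
Qed.

Lemma epi_surj_Oplus (X Y : Ob (Oplus sigma v)) (f : Defs.Hom X Y) :
  epi f -> forall y : Oplus_module Y, exists x, (f : grHom _ _) x = y.
Proof.
move=> epif y; apply: coker_pi_eq0.
pose g : grHom X Y := f.
have gr i x : exists x', hcomp i (g x) = g x' by exists (hcomp i x); exact: grHom_hcomp.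
pose C := @OplusObject _ _ _ (graded_coker gr)
  (coker_nilpotent (f := g) (@Oplus_nilpotent _ _ _ Y)).
have qh i x : homogeneous i x -> homogeneous (M := C) i (coker_pi g x).
  by move=> hx; rewrite /homogeneous [LHS]coker_hcomp_pi // hx.
have zh i x : homogeneous i x -> homogeneous (M := C) i ((\0 : {linear Y -> C}) x).
  by move=> _; exact: hcomp0.
pose q : Defs.Hom (c := Oplus sigma v) Y C := GrHom qh.
pose z : Defs.Hom (c := Oplus sigma v) Y C := GrHom zh.
suff qz : q = z by rewrite -[LHS]/((q : grHom _ _) y) qz.
apply: epif; apply: grHom_ext => x /=.
have <- : coker_pi g 0 = 0 by exact: raddf0.
by apply/coker_piP; exists x; rewrite subr0.
Qed.

End GradedMaps.

(** * Projectivity and generation *)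

Section LiftingAndSeparation.
Variables (R : comPzRingType) (sigma : ringAut R) (v : R).
Local Notation A := (gwa sigma v).
Local Notation coef := (@gwa_coef R sigma v).
Local Notation tp := (@tplus R sigma v).
Local Notation tm := (@tminus R sigma v).
Local Notation Z := (Zset v).
Local Notation avoids := (avoids sigma v).
Hypothesis star : condition_star sigma v.
Hypothesis nR : noetherian R.

(** Any preimage of a weight vector becomes one after applying an idempotent
from a large enough quotient, which fixes the image. *)
Lemma weight_vector_lift W N (X Y : lmodType A) (f : {linear X -> Y}) (x : X) :
  pi0 Z W -> avoids W N -> locally_nilpotent X -> weight_vector W N (f x) ->
  exists r, weight_vector W N (coef r *: x) /\ f (coef r *: x) = f x.
Proof.
move=> pW NW /(_ x) [k kP] wfx.
exists (idempotent_lift (Amod sigma v (maxn N k)) W); split.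
  by apply: weight_vector_proj; rewrite ?leq_maxl ?kP ?leq_maxr.
by rewrite linearZ /= (weight_vector_fixed star nR pW _ wfx) ?leq_maxl.
Qed.

(** A nonzero vector [d x] has a nonzero multiple [y] killed by [tminus], hence by
[v].  A prime containing the annihilator of [y] lies on some component [W] of
[Z], and the idempotents of [W], being outside that prime, do not kill [y]. *)
Lemma weight_vector_separate (X Y : lmodType A) (d : {linear X -> Y}) (x : X) :
  locally_nilpotent X -> d x != 0 ->
  exists W, pi0 Z W /\ exists j, forall N, avoids W N -> exists r,
    weight_vector W N (coef r *: (tm ^+ j *: x)) /\ d (coef r *: (tm ^+ j *: x)) != 0.
Proof.
move=> nX dx0.
have exk : exists k, tm ^+ k *: d x == 0.
  by have [k kP] := nX x; exists k; rewrite -linearZ kP ?raddf0.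
case: (ex_minnP exk) => [[|j] jy jmin]; first by rewrite scale1r (negPf dx0) in jy.
pose y := tm ^+ j *: d x.
have y0 : y != 0 by apply/negP => /jmin; rewrite ltnn.
have tmy : tm *: y = 0 by rewrite scalerA -exprS; exact/eqP.
pose I := [set r | coef r *: y = 0].
have iI : is_ideal I.
  split=> [|a b|a b]; rewrite /I /= ?rmorph0 ?scale0r //.
    by rewrite rmorphD scalerDl => -> ->; rewrite addr0.
  by rewrite rmorphM -scalerA => ->; rewrite scaler0.
have [n|p [Ip _]] := exists_prime nR (s := 1) iI.
  by rewrite expr1n /I /= rmorph1 scale1r => /eqP; rewrite (negPf y0).
have Zp : Z p by apply: Ip; rewrite /I /= -tplus_tminus -scalerA tmy scaler0.
set W := connected_component Z p; have pW : pi0 Z W by exact: pi0_component.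
exists W; split=> //; exists j => N NW.
have [k kP] := nX (tm ^+ j *: x); pose m := maxn N k.
have xm : tm ^+ m *: (tm ^+ j *: x) = 0 by rewrite kP ?leq_maxr.
exists (idempotent_lift (Amod sigma v m) W); split.
  by apply: weight_vector_proj; rewrite ?leq_maxl.
apply/negP; rewrite linearZ linearZ => /eqP ey.
have Im : ann (Amod sigma v m) `<=` spec_ideal p.
  by move=> r rm; apply: Ip; apply: ann_Amod_kill rm; rewrite /y -!linearZ xm raddf0.
have [eW _] := idempotent_lift_supp star nR pW Im.
by apply: eW; [exact: connected_component_refl|exact: Ip].
Qed.

Lemma PW_map_unique W N (M : lmodType A)
    (f g : {linear PW sigma v W N -> M}) :
  f (PW_gen sigma v W N) = g (PW_gen sigma v W N) -> f =1 g.
Proof. by move=> fg y; have [a ->] := PW_gen_span y; rewrite !linearZ /= fg. Qed.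

(** The shift places the generator in degree [- n]. *)
Lemma PW_map_homogeneous W N (n : int) (X : gradedModule sigma v)
    (h : {linear PW sigma v W N -> X}) :
  homogeneous (- n) (h (PW_gen sigma v W N)) ->
  forall i (y : gshift (PW sigma v W N) n), homogeneous i y -> homogeneous i (h y).
Proof.
move=> hm i y; have [a ->] := PW_gen_span y => hy.
have {hy} <- : gwa_hcomp (i + n) a *: PW_gen sigma v W N = a *: PW_gen sigma v W N.
  rewrite -[RHS]hy -(hcomp_scale_homogeneous _ _ (PW_gen_homogeneous _ _ _ _)).
  by rewrite addr0.
rewrite linearZ /homogeneous -{1}(addrK n i) hcompZ; last exact: gwa_hcomp_homog.
by rewrite hm.
Qed.

Lemma PW_projective W N : pi0 Z W -> avoids W N ->
  projective_object (C := Ocat sigma v) (forget_grading (PW sigma v W N)).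
Proof.
move=> pW NW X Y f g /epi_surj_Ocat fsurj; set G := PW_gen sigma v W N.
have wG : weight_vector W N G by exact: PW_gen_weight.
have [x0 x0E] := fsurj ((g : {linear PW sigma v W N -> _}) G).
have wf : weight_vector W N ((f : {linear _ -> _}) x0).
  by rewrite x0E; exact: weight_vector_linear.
have [r [wx fx]] := weight_vector_lift pW NW (@O_nilpotent _ _ _ X) wf.
have [h hG] := exists_PW_map wx; exists h; apply: linear_ext.
by apply: PW_map_unique => //=; rewrite hG fx.
Qed.

Lemma Oshift_PW_projective W N n : pi0 Z W -> avoids W N ->
  projective_object (C := Oplus sigma v) (Oshift (PW sigma v W N) n).
Proof.
move=> pW NW X Y f g /epi_surj_Oplus fsurj; set G := PW_gen sigma v W N.
have wG : weight_vector W N G by exact: PW_gen_weight.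
pose f' : grHom X Y := f; pose g' : grHom (gshift (PW sigma v W N) n) Y := g.
have gG : homogeneous (- n) (g' G).
  by apply: gr_homogeneous; rewrite /homogeneous /= /gshift_hcomp addNr; exact: PW_gen_homogeneous.
have [x1 x1E] := fsurj (g' G); pose x0 := hcomp (- n) x1.
have x0E : f' x0 = g' G by rewrite -grHom_hcomp x1E.
have wf : weight_vector W N (f' x0).
  by rewrite x0E; exact: (weight_vector_linear (g' : {linear PW sigma v W N -> Y})).
have [r [wx fx]] := weight_vector_lift pW NW (@Oplus_nilpotent _ _ _ X) wf.
have [h hG] := exists_PW_map wx.
have hh : homogeneous (- n) (h G).
  rewrite hG /homogeneous -{1}[- n]add0r hcompZ; last exact: homog_coef.
  by rewrite /x0 hcompK eqxx.
exists (@GrHom _ _ _ (gshift (PW sigma v W N) n) X h (PW_map_homogeneous hh)).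
apply: grHom_ext; apply: (PW_map_unique (f := f' \o h) (g := g')).
by rewrite /= hG fx.
Qed.

End LiftingAndSeparation.

Theorem proposition3p5 (K : realType) (R : comPzRingType)
    (iota : {rmorphism K[i] -> R}) (R_fg : fg_algebra iota)
    (sigma : ringAut R) (sigma_linear : forall c : K[i], sigma (iota c) = iota c)
    (v : R) (star : condition_star sigma v)
    (N : set (Spec R) -> nat)
    (N_large : forall W, pi0 (Zset v) W -> forall n : nat, (N W <= n)%N ->
       W `&` (Xi_pow sigma n%:Z @` Zset v) = set0) :
  projective_generators (C := Oplus sigma v)
    (fun i : {W : set (Spec R) | pi0 (Zset v) W} * int =>
       Oshift (PW sigma v (sval i.1) (N (sval i.1))) i.2)
  /\
  projective_generators (C := Ocat sigma v)
    (fun W : {W : set (Spec R) | pi0 (Zset v) W} =>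
       forget_grading (PW sigma v (sval W) (N (sval W)))).
Proof.
have nR := noetherian_fg_algebra R_fg.
split; split.
- by move=> [[W pW] n]; apply: Oshift_PW_projective => //; exact: N_large.
- move=> X Y f g fg; pose f' : grHom X Y := f; pose g' : grHom X Y := g.
  apply: grHom_ext => x; apply: contrapT => /eqP; rewrite -subr_eq0 => dx.
  pose d : {linear X -> Y} := f' \- g'.
  (* a graded map may be tested on homogeneous vectors *)
  have [i dxi] : exists i, d (hcomp i x) != 0.
    apply: contrapT => /forallNP d0; move/negP: dx; apply; apply/eqP.
    rewrite -[LHS]/(d x); have [s [_ _ ->]] := hcomp_seq x.
    by rewrite raddf_sum big1 // => j _; apply/eqP/negPn/negP/d0.
  have [W [pW [j /(_ _ (N_large W pW)) [r [wx dx0]]]]] :=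
    weight_vector_separate star nR (@Oplus_nilpotent _ _ _ X) dxi.
  have [h hG] := exists_PW_map wx.
  (* tminus ^+ j moves degree i to i - j, where the shift by j - i puts the generator *)
  have hh : homogeneous (- (j%:Z - i)) (h (PW_gen sigma v W (N W))).
    rewrite hG opprB addrC /homogeneous -{1}[_ + i]add0r hcompZ; last exact: homog_coef.
    by rewrite hcompZ ?hcompK ?eqxx //; exact: homog_tminusX.
  have := fg (exist _ W pW, j%:Z - i)
    (@GrHom _ _ _ (gshift (PW sigma v W (N W)) (j%:Z - i)) X h (PW_map_homogeneous hh)).
  move=> /(congr1 (fun k : grHom (gshift (PW sigma v W (N W)) (j%:Z - i)) Y =>
                     k (PW_gen sigma v W (N W)))) /= /eqP.
  by rewrite hG -subr_eq0; apply/negP.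
- by move=> [W pW]; apply: PW_projective => //; exact: N_large.
- move=> X Y f g fg; apply: linear_ext => x; apply: contrapT => /eqP.
  rewrite -subr_eq0 => dx; pose f' : {linear X -> Y} := f; pose g' : {linear X -> Y} := g.
  pose d : {linear X -> Y} := f' \- g'.
  have [W [pW [j /(_ _ (N_large W pW)) [r [wx dx0]]]]] :=
    weight_vector_separate star nR (d := d) (@O_nilpotent _ _ _ X) dx.
  have [h hG] := exists_PW_map wx; have := fg (exist _ W pW) h.
  move=> /(congr1 (fun k : {linear PW sigma v W (N W) -> Y} =>
                     k (PW_gen sigma v W (N W)))) /= /eqP.
  by rewrite hG -subr_eq0; apply/negP.
Qed.
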